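(* Let $a\neq0$ be a real number. An admissible isotropic rotational surface has a constant ratio $a$ of isotropic principal curvatures if and only if it is isotropic similar to a subset, on which $K\neq 0$, of one of the surfaces $$z=(x^2+y^2)^{(1+a)/2}\quad\text{or}\quad z=(x^2+y^2)^{(1+a)/(2a)},\qquad\text{if } a\neq-1;$$ $$z=\log(x^2+y^2),\qquad\text{if } a=-1.$$
   Context: We work in $\mathbb{R}^3$ with coordinates $x,y,z$. A surface is an embedded connected 2-dimensional $C^3$ submanifold of $\mathbb{R}^3$, possibly with boundary and possibly non-compact. A surface is admissible if none of its tangent planes is parallel to the $z$-axis; it is then locally a graph $z=f(x,y)$. The isotropic principal curvatures $\kappa_1,\kappa_2$ at a point are the eigenvalues of the Hessian $\nabla^2 f$; $H=\frac{\kappa_1+\kappa_2}{2}$ and $K=\kappa_1\kappa_2$ are the isotropic mean and Gaussian curvatures. An admissible surface has a constant ratio $a$ of isotropic principal curvatures if $K\neq0$ and ($\kappa_1/\kappa_2=a$ or $\kappa_2/\kappa_1=a$) at each of its points. A general isotropic similarity is an invertible affine map $\mathbf{x}\mapsto A\mathbf{x}+\mathbf{b}$ of $\mathbb{R}^3$ with $A=\begin{pmatrix}\pm h_1&\mp h_2&0\\ h_2&h_1&0\\ c_1&c_2&c_3\end{pmatrix}$, $\mathbf b\in\mathbb{R}^3$, $h_1,h_2,c_1,c_2,c_3\in\mathbb{R}$; it is an isotropic congruence if $h_1=\cos\phi$, $h_2=\sin\phi$, $c_3=1$. Two sets are isotropic similar if some general isotropic similarity takes one to the other. A surface invariant under all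 rotations about the $z$-axis, and the image of such a surface under any isotropic congruence, is called isotropic rotational. *)

(* Defs.v *)
From HB Require Import structures.
From mathcomp Require Import all_boot all_order all_algebra.
From mathcomp Require Import all_classical all_reals all_analysis.
Set Implicit Arguments. Unset Strict Implicit. Unset Printing Implicit Defensive.
Import Order.TTheory GRing.Theory Num.Theory.
Import numFieldNormedType.Exports.
Local Open Scope classical_set_scope.
Local Open Scope ring_scope.

Section Defs.
Context {R : realType}.

(* [f] is of class C^k on the open set [U]; on a finite-dimensional [V] this is
   continuity of the iterated directional derivatives up to order [k]. *)
Fixpoint class_C {V W : normedModType R} (k : nat) (U : set V) (f : V -> W)
    : Prop :=
  match k with
  | 0%N => forall x, U x -> {for x, continuous f}
  | k'.+1 => (forall x, U x -> differentiable f x) /\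
             (forall v, class_C k' U (fun x => 'D_v f x))
  end.

Definition xcoord (p : 'rV[R]_3) : R := p 0 0.
Definition ycoord (p : 'rV[R]_3) : R := p 0 1.
Definition zcoord (p : 'rV[R]_3) : R := p 0 2.
Definition top_view (p : 'rV[R]_3) : 'rV[R]_2 :=
  \row_i nth 0 [:: xcoord p; ycoord p] i.
Definition e_z : 'rV[R]_3 := delta_mx 0 2.

Definition half_plane : set 'rV[R]_2 := [set u | 0 <= u 0 0].

(* [psi], of class C^3 on the open set [W], restricts to an immersion on
   [W `&` half_plane] and to a homeomorphism from it onto a relatively open
   subset of [S]. Interior charts are those with [W] inside the open half-plane. *)
Definition chart (S : set 'rV[R]_3) (W : set 'rV[R]_2)
    (psi : 'rV[R]_2 -> 'rV[R]_3) : Prop :=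
  [/\ open W,
      class_C 3 W psi,
      (forall u, (W `&` half_plane) u -> injective ('d psi u)) &
      exists O : set 'rV[R]_3, exists g : 'rV[R]_3 -> 'rV[R]_2,
        [/\ open O,
            psi @` (W `&` half_plane) = S `&` O,
            (forall u, (W `&` half_plane) u -> g (psi u) = u) &
            {within S `&` O, continuous g}]].

Definition surface (S : set 'rV[R]_3) : Prop :=
  connected S /\
  forall p, S p -> exists W psi,
    chart S W psi /\ (psi @` (W `&` half_plane)) p.

(* At a boundary point this is the full plane, not a half-plane. *)
Definition tangent_plane (S : set 'rV[R]_3) (p : 'rV[R]_3) : set 'rV[R]_3 :=
  [set v | exists W psi u,
     [/\ chart S W psi, (W `&` half_plane) u, psi u = p &
         exists w, v = 'd psi u w]].

Definition admissible (S : set 'rV[R]_3) : Prop :=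
  surface S /\ forall p, S p -> ~ tangent_plane S p e_z.

(* Near [p], the set [S] is the part of the graph z = f(x,y) lying over the top
   view of [S], which at a boundary point of [S] is not a neighbourhood of
   [top_view p]: there, [f] is a C^3 extension across the boundary, and its
   derivatives at [top_view p] up to order 3 do not depend on the extension. *)
Definition local_graph (S : set 'rV[R]_3) (p : 'rV[R]_3)
    (f : 'rV[R]_2 -> R) : Prop :=
  (exists U : set 'rV[R]_2, [/\ open U, U (top_view p) & class_C 3 U f]) /\
  (\forall q \near p, S q -> zcoord q = f (top_view q)).

Definition hessian (f : 'rV[R]_2 -> R) (u : 'rV[R]_2) : 'M[R]_2 :=
  \matrix_(i, j) 'D_(delta_mx 0 i) (fun v => 'D_(delta_mx 0 j) f v) u.

(* [k1], [k2] are the eigenvalues of the Hessian, counted with multiplicity. *)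
Definition principal_curvatures (S : set 'rV[R]_3) (p : 'rV[R]_3)
    (k1 k2 : R) : Prop :=
  exists f, local_graph S p f /\
    char_poly (hessian f (top_view p)) = ('X - k1%:P) * ('X - k2%:P).

Definition gaussian_curvature (S : set 'rV[R]_3) (p : 'rV[R]_3) (K : R)
    : Prop :=
  exists k1 k2, principal_curvatures S p k1 k2 /\ K = k1 * k2.

Definition constant_ratio (a : R) (S : set 'rV[R]_3) : Prop :=
  forall p, S p -> exists k1 k2,
    [/\ principal_curvatures S p k1 k2, k1 * k2 != 0 &
        k1 / k2 = a \/ k2 / k1 = a].

(* [s = false] selects the upper signs and [s = true] the lower ones. *)
Definition isotropic_mx (s : bool) (h1 h2 c1 c2 c3 : R) : 'M[R]_3 :=
  \matrix_(i, j) nth 0 (nth [::]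
    [:: [:: (-1) ^+ s * h1; - ((-1) ^+ s * h2); 0];
        [:: h2; h1; 0];
        [:: c1; c2; c3]] i) j.

(* x |-> A x + b, points being row vectors. *)
Definition affine_map (A : 'M[R]_3) (b x : 'rV[R]_3) : 'rV[R]_3 :=
  x *m A^T + b.

Definition general_isotropic_similarity (T : 'rV[R]_3 -> 'rV[R]_3) : Prop :=
  exists s h1 h2 c1 c2 c3 b,
    isotropic_mx s h1 h2 c1 c2 c3 \in unitmx /\
    T = affine_map (isotropic_mx s h1 h2 c1 c2 c3) b.

Definition isotropic_congruence (T : 'rV[R]_3 -> 'rV[R]_3) : Prop :=
  exists s phi c1 c2 b,
    T = affine_map (isotropic_mx s (cos phi) (sin phi) c1 c2 1) b.

(* The general isotropic similarities form a group, so this is symmetric. *)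
Definition isotropic_similar (A B : set 'rV[R]_3) : Prop :=
  exists T, general_isotropic_similarity T /\ T @` A = B.

Definition z_rotation (phi : R) : 'rV[R]_3 -> 'rV[R]_3 :=
  affine_map (isotropic_mx false (cos phi) (sin phi) 0 0 1) 0.

Definition isotropic_rotational (S : set 'rV[R]_3) : Prop :=
  exists S0 T,
    [/\ surface S0, (forall phi, z_rotation phi @` S0 = S0),
        isotropic_congruence T & T @` S0 = S].

(* x^2 + y^2 *)
Definition axis_dist2 (p : 'rV[R]_3) : R := xcoord p ^+ 2 + ycoord p ^+ 2.

(* z = (x^2 + y^2)^b; the axis is in the domain only if [0 < b], whereas the
   total function [powR] also has values at base 0 for [b <= 0]. *)
Definition power_surface (b : R) : set 'rV[R]_3 :=
  [set p | (0 < axis_dist2 p \/ 0 < b) /\ zcoord p = axis_dist2 p `^ b].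

Definition log_surface : set 'rV[R]_3 :=
  [set p | 0 < axis_dist2 p /\ zcoord p = ln (axis_dist2 p)].

Definition model_surface (a : R) (M : set 'rV[R]_3) : Prop :=
  (a != -1 /\
   (M = power_surface ((1 + a) / 2) \/ M = power_surface ((1 + a) / (2 * a))))
  \/ (a = -1 /\ M = log_surface).

End Defs.

(* Main.v *)
Require Import Defs.
From HB Require Import structures.
From mathcomp Require Import all_boot all_order all_algebra.
From mathcomp Require Import all_classical all_reals all_analysis.
From mathcomp Require Import ring lra.
Set Implicit Arguments. Unset Strict Implicit. Unset Printing Implicit Defensive.
Import Order.TTheory GRing.Theory Num.Theory.
Import numFieldNormedType.Exports.
Local Open Scope classical_set_scope.
Local Open Scope ring_scope.

(** Rotating a surface of revolution into the half-plane [y = 0 <= x] gives its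
    profile, locally [z = h(r)] with [r] the distance to the axis. The principal
    curvatures are [h''] along the profile and [h' / r] along the circle, hence
    the ratio is [a] exactly when [r h'' = e h'] with [e = a] or [e = a^-1], that
    is when [h'] is a multiple of [r^e], and [h] has the form [C r^(1 + e) + D],
    or [C log r + D] if [e = -1]. A similarity removes [C] and [D].

    The work lies in making this rigorous for a set that is only known to be a
    surface with boundary, invariant under rotations. First, the profile must
    cover an interval of radii near each of its points: this is
    [radii_interval], which rests on [chart_radius_not_constant], a patch on
    which the radius is constant being excluded by the local graph property.
    Next, a local graph [f] is constrained only over the top view of [S], which
    at a boundary point is not a neighbourhood; all derivatives are obtained from
    identities along circles ([circle_partials]) and along the profile
    ([profile_hessian]), by the principle that a differentiable function with
    zeros accumulating at a point has derivative 0 there ([derive_limit_zeros]).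
    They make the Hessian at [(r, 0)] triangular with diagonal entries [h''] and
    [h' / r], and scalar on the axis, so that only [a = 1] allows a point of the
    axis. This gives [local_profile]. The parameters [e], [C], [D] are determined
    by any small piece of [S] ([profile_params_unique]), so they are locally
    constant and, [S] being connected, constant ([global_profile]).

    Conversely, [model_curvatures] computes the curvatures of the models and
    [principal_curvatures_pullback] carries them through a similarity, which
    scales both by one factor. On the axis a model need not be smooth, and
    [power_surface_axis] shows that nonzero Gaussian curvature there forces
    [e = 1]. *)

(** * Zeros and derivatives of functions of one real variable *)

Section OneVariable.
Context {R : realType}.
Implicit Types (phi : R -> R) (r s : R) (Z J : set R).

Lemma limit_point_near Z r (P : set R) :
  limit_point Z r -> (\forall s \near r, P s) -> exists s, [/\ s != r, Z s & P s].
Proof. by move=> /[apply] -[s []]; exists s. Qed.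

Lemma is_derive_continuous phi r d :
  is_derive r 1 phi d -> {for r, continuous phi}.
Proof.
by move=> [phi' _]; apply: differentiable_continuous; apply/derivable1_diffP.
Qed.

(** The zeros need not fill a neighbourhood of [r]: they only prevent [phi] and
    its difference quotient at [r] from having nonzero limits. This is how
    derivatives are determined at a boundary point of a surface, where only
    one side is available. *)
Lemma derive_limit_zeros phi r d Z :
  is_derive r 1 phi d -> limit_point Z r ->
  (\forall s \near r, Z s -> phi s = 0) -> phi r = 0 /\ d = 0.
Proof.
move=> dphi rZ phi0.
have phir : phi r = 0.
  have [//|phir] := eqVneq (phi r) 0; exfalso.
  have near_ne0 : \forall s \near r, phi s != 0.
    exact: (cvgr_neq0 _ (is_derive_continuous dphi) phir).
  have [s [_ Zs [/(_ Zs) /eqP + /negP //]]] := limit_point_near rZ (filterI phi0 near_ne0).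
split=> //; have [//|d0] := eqVneq d 0; exfalso.
have : (h^-1 *: ((phi \o shift r) (h *: 1) - phi r) : R) @[h --> 0^'] --> d.
  by case: dphi => + <-.
move=> /cvgr_neq0 -/(_ d0).
rewrite /= /dnbhs near_withinE => /= near_ne0.
have : \forall s \near r, s != r -> phi s != 0.
  have : (s - r : R) @[s --> r] --> (0 : R).
    by rewrite -[X in _ --> X](subrr r); apply: (@cvgB _ _ _ _ _ id (cst r));
      [exact: cvg_id|exact: cvg_cst].
  move=> /(_ _ near_ne0) /= shifted; apply: (@filterS _ (nbhs r) _ _ _ _ shifted) => s /= + sr.
  rewrite subr_eq0 => /(_ sr); apply: contraNN => /eqP.
  by rewrite phir [_ *: 1]mulr1 subrK => ->; rewrite subr0 scaler0.
move=> near_ne0'.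
have [s [sr Zs [/(_ Zs) /eqP + /(_ sr) /negP//]]] :=
  limit_point_near rZ (filterI phi0 near_ne0').
Qed.

(** Zeros in a set without isolated points propagate to the derivative. *)
Lemma derive_flat phi (phi1 : R -> R) r J :
  (forall s, J s -> limit_point J s) ->
  (\forall s \near r, is_derive (s : R) 1 phi (phi1 s)) ->
  (\forall s \near r, J s -> phi s = 0) ->
  \forall s \near r, J s -> phi1 s = 0.
Proof.
move=> Jlim dphi /near_join phi0; near=> s => Js.
have dphi_s : is_derive s 1 phi (phi1 s) by near: s.
apply: (proj2 (derive_limit_zeros dphi_s (Jlim _ Js) _)).
by near: s.
Unshelve. all: by end_near. Qed.

Lemma is_derive0_interval_cst phi J :
  is_interval J -> (forall s, J s -> is_derive s 1 phi 0) ->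
  forall r s, J r -> J s -> phi r = phi s.
Proof.
move=> Jitv dphi.
have lt_cst r s : r < s -> J r -> J s -> phi r = phi s.
  move=> rs Jr Js.
  have Jrs x : x \in `[r, s] -> J x.
    by rewrite in_itv /=; exact: Jitv.
  have [||c _] := @MVT _ phi (cst 0) r s rs.
  - by move=> x xrs; apply/dphi/Jrs; apply: subset_itv_oo_cc xrs.
  - apply: derivable_within_continuous => x xrs.
    by case: (dphi x (Jrs _ xrs)).
  by rewrite mul0r => /eqP; rewrite subr_eq0 => /eqP.
move=> r s Jr Js; have [rs|sr|->//] := ltgtP r s; first exact: lt_cst.
by apply/esym/lt_cst.
Qed.

Lemma limit_pointT r : limit_point [set: R] r.
Proof.
move=> U /nbhs_ballP[e /= e0 eU]; exists (r + e / 2); split => //.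
  by rewrite -subr_eq0 addrC addKr gt_eqF// divr_gt0.
apply: eU; rewrite /ball /= opprD addrA subrr add0r normrN gtr0_norm ?divr_gt0//.
by rewrite ltr_pdivrMr// ltr_pMr// ltr1n.
Qed.

Lemma is_derive_circle0 r (X Y : R -> R) dX dY :
  is_derive (0 : R) 1 X dX -> is_derive (0 : R) 1 Y dY ->
  is_derive (0 : R) 1 (fun t => - (r * sin t) * X t + r * cos t * Y t)
    (- r * X 0 + r * dY).
Proof.
move=> dX0 dY0.
have drsin : is_derive (0 : R) 1 (fun t : R => - (r * sin t)) (- r).
  by apply: is_derive_eq; rewrite /GRing.scale /= cos0; ring.
have drcos : is_derive (0 : R) 1 (fun t : R => r * cos t) 0.
  by apply: is_derive_eq; rewrite /GRing.scale /= sin0; ring.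
apply: is_derive_eq (is_deriveD (is_deriveM drsin dX0) (is_deriveM drcos dY0)) _.
by rewrite /GRing.scale /= sin0 cos0; ring.
Qed.

Lemma limit_point_pos : limit_point [set t : R | 0 < t] 0.
Proof.
move=> U /nbhs_ballP[e /= e0 eU]; exists (e / 2); split => //=.
- by rewrite gt_eqF// divr_gt0.
- by rewrite divr_gt0.
apply: eU; rewrite /ball /= add0r normrN gtr0_norm ?divr_gt0//.
by rewrite ltr_pdivrMr// ltr_pMr// ltr1n.
Qed.

Lemma positive_limit_point J r s :
  is_interval J -> J r -> J s -> s != r -> (forall t, J t -> 0 <= t) ->
  limit_point [set t | J t /\ 0 < t] r.
Proof.
move=> Jitv Jr Js sr J0 U /nbhs_ballP[e /= e0 eU].
have r0 := J0 _ Jr; have s0 := J0 _ Js.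
have e20 : 0 < e / 2 by rewrite divr_gt0.
have e2e : e / 2 < e by rewrite ltr_pdivrMr// ltr_pMr// ltr1n.
have [rs|sr'] : r < s \/ s < r by apply/orP; rewrite -neq_lt eq_sym.
- pose d := Num.min (e / 2) (s - r).
  have d0 : 0 < d by rewrite lt_min e20 subr_gt0.
  have de : d <= e / 2 by rewrite ge_min lexx.
  have ds : d <= s - r by rewrite ge_min lexx orbT.
  exists (r + d); split.
  + by rewrite -subr_eq0 addrC addKr gt_eqF.
  + by split; [apply: (Jitv r s) => //; lra|lra].
  + by apply: eU; rewrite /ball /= opprD addrA subrr add0r normrN gtr0_norm//; lra.
- pose d := Num.min (e / 2) ((r - s) / 2).
  have d0 : 0 < d by rewrite lt_min e20 divr_gt0 ?subr_gt0.
  have de : d <= e / 2 by rewrite ge_min lexx.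
  have ds : d <= (r - s) / 2 by rewrite ge_min lexx orbT.
  exists (r - d); split.
  + by rewrite -subr_eq0 addrC addKr oppr_eq0 gt_eqF.
  + by split; [apply: (Jitv s r) => //; lra|lra].
  + by apply: eU; rewrite /ball /= opprB addrC subrK gtr0_norm//; lra.
Qed.

Lemma limit_point_pos_self (t : R) : 0 < t -> limit_point [set s : R | 0 < s] t.
Proof.
move=> t0; have := @positive_limit_point [set s | 0 < s] t (t + 1).
have -> : [set s : R | [set s | 0 < s] s /\ 0 < s] = [set s | 0 < s].
  by apply/seteqP; split=> [x []|x Px].
apply=> //=.
- by move=> x y x0 y0 z /andP[xz _]; exact: lt_le_trans xz.
- by rewrite addr_gt0.
- by rewrite gt_eqF// ltrDl.
- by move=> x /ltW.
Qed.

(** By the intermediate value theorem the mean of two distinct values would be a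
    value as well. *)
Lemma two_valued_cst (w : R -> R) J (a b : R) :
  is_interval J -> (forall s, J s -> {for s, continuous w}) ->
  (forall s, J s -> w s = a \/ w s = b) -> forall s t, J s -> J t -> w s = w t.
Proof.
move=> Jitv wc wab.
have lt_cst s t : s < t -> J s -> J t -> w s = w t.
  move=> st Js Jt; have [//|wst] := eqVneq (w s) (w t).
  have Jst x : x \in `[s, t] -> J x by rewrite in_itv /=; exact: Jitv.
  have wcont : {within `[s, t], continuous w}.
    by apply: continuous_in_subspaceT => x; rewrite inE /= => /Jst/wc.
  have [|c cst wc2] := @IVT _ w s t ((w s + w t) / 2) (ltW st) wcont.
    by rewrite ge_min le_max; case: (leP (w s) (w t)) => ?; apply/andP; split;
      apply/orP; (try by left; lra); right; lra.
  have := wab _ (Jst _ cst); rewrite wc2.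
  have := wab _ Js; have := wab _ Jt; move: wst.
  move: (w s) (w t) => x y /eqP xy yab xab mab.
  by exfalso; apply: xy; case: yab => ?; case: xab => ?; case: mab => ?; lra.
move=> s t Js Jt; have [st|ts|->//] := ltgtP s t; first exact: lt_cst.
by apply/esym/lt_cst.
Qed.

End OneVariable.

(** * Coordinates and partial derivatives *)

Section Coordinates.
Context {R : realType}.
Implicit Types (f : 'rV[R]_2 -> R) (x y z : R).

Definition pt2 x y : 'rV[R]_2 := \row_i nth 0 [:: x; y] i.
Definition pt3 x y z : 'rV[R]_3 := \row_i nth 0 [:: x; y; z] i.

Lemma pt2E (u : 'rV[R]_2) : u = pt2 (u 0 0) (u 0 1).
Proof. by apply/rowP => -[[|[|[]]]] // i; rewrite mxE /=; congr (u _ _); apply/val_inj. Qed.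

Lemma pt3E (p : 'rV[R]_3) : p = pt3 (xcoord p) (ycoord p) (zcoord p).
Proof. by apply/rowP => -[[|[|[|[]]]]] // i; rewrite mxE /=; congr (p _ _); apply/val_inj. Qed.

Lemma xcoord_pt3 x y z : xcoord (pt3 x y z) = x. Proof. by rewrite /xcoord mxE. Qed.
Lemma ycoord_pt3 x y z : ycoord (pt3 x y z) = y. Proof. by rewrite /ycoord mxE. Qed.
Lemma zcoord_pt3 x y z : zcoord (pt3 x y z) = z. Proof. by rewrite /zcoord mxE. Qed.
Lemma top_view_pt3 x y z : top_view (pt3 x y z) = pt2 x y.
Proof. by rewrite /top_view xcoord_pt3 ycoord_pt3. Qed.

Lemma pt3_lincomb (a b x y z x' y' z' : R) :
  a *: pt3 x y z + b *: pt3 x' y' z' =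
  pt3 (a * x + b * x') (a * y + b * y') (a * z + b * z').
Proof. by apply/rowP => -[[|[|[|[]]]]] // i; rewrite !mxE. Qed.

Definition coord_pt3 := (xcoord_pt3, ycoord_pt3, zcoord_pt3, top_view_pt3).

Lemma cvg_mx {T : Type} {F : set_system T} {FF : Filter F} m n
    (f : T -> 'M[R]_(m, n)) (M : 'M[R]_(m, n)) :
  (forall i j, f t i j @[t --> F] --> M i j) -> f @ F --> M.
Proof.
move=> fM A [P MP PA].
have : \forall t \near F, forall i, forall j, P i j (f t i j).
  by apply: filter_forall => i; apply: filter_forall => j; exact: (fM i j).
by apply: filterS => t Pt; exact: PA.
Qed.

Lemma cvg_pt2 {T : Type} {F : set_system T} {FF : Filter F} (fx fy : T -> R) x y :
  fx @ F --> x -> fy @ F --> y -> (fun t => pt2 (fx t) (fy t)) @ F --> pt2 x y.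
Proof.
move=> fxx fyy; apply: cvg_mx => i j; rewrite !mxE.
by case: j => [[|[|[]]]] // jlt; under eq_fun do rewrite !mxE /=;
  [exact: fxx|exact: fyy].
Qed.

Lemma cvg_pt3 {T : Type} {F : set_system T} {FF : Filter F} (fx fy fz : T -> R) x y z :
  fx @ F --> x -> fy @ F --> y -> fz @ F --> z ->
  (fun t => pt3 (fx t) (fy t) (fz t)) @ F --> pt3 x y z.
Proof.
move=> fxx fyy fzz; apply: cvg_mx => i j; rewrite !mxE.
by case: j => [[|[|[|[]]]]] // jlt; under eq_fun do rewrite !mxE /=;
  [exact: fxx|exact: fyy|exact: fzz].
Qed.

Lemma top_view_continuous : continuous (@top_view R).
Proof.
move=> p; exact: (cvg_pt2 (@coord_continuous R 1 3 0 0 p)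
                          (@coord_continuous R 1 3 0 1 p)).
Qed.

Definition e0 : 'rV[R]_2 := delta_mx 0 0.
Definition e1 : 'rV[R]_2 := delta_mx 0 1.

Lemma coord_basis :
  (e0 0 0 = 1) * (e0 0 1 = 0) * (e1 0 0 = 0) * (e1 0 1 = 1).
Proof. by rewrite !mxE. Qed.

Lemma pt2_basis x y : pt2 x y = x *: e0 + y *: e1.
Proof.
by apply/rowP => -[[|[|[]]]] // i; rewrite !mxE /= ?mulr1 ?mulr0 ?addr0 ?add0r.
Qed.

Lemma diff_partials (W : normedModType R) (f : 'rV[R]_2 -> W) u w :
  differentiable f u -> 'd f u w = w 0 0 *: 'D_e0 f u + w 0 1 *: 'D_e1 f u.
Proof.
by move=> df; rewrite !deriveE // [w in LHS]pt2E pt2_basis linearD !linearZ.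
Qed.

(** Chain rule along a plane curve. All that a surface tells about a local graph
    is its restriction to curves staying in the top view of the surface. *)
Lemma is_derive_curve f (cx cy : R -> R) (t dx dy : R) :
  is_derive t 1 cx dx -> is_derive t 1 cy dy ->
  differentiable f (pt2 (cx t) (cy t)) ->
  is_derive t 1 (fun s => f (pt2 (cx s) (cy s)))
    (dx * 'D_e0 f (pt2 (cx t) (cy t)) + dy * 'D_e1 f (pt2 (cx t) (cy t))).
Proof.
move=> [cx1 cxd] [cy1 cyd] df; set c := fun s => pt2 (cx s) (cy s).
have c0 i : (fun s => c s i 0) = cx by apply/funext => s; rewrite mxE.
have c1 i : (fun s => c s i 1) = cy by apply/funext => s; rewrite mxE.
have ord2 (j : 'I_2) : j = 0 \/ j = 1.
  by case: j => [[|[|//]] jlt]; [left|right]; exact/val_inj.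
have dc : derivable c t 1.
  apply/derivable_mxP => i j; case: (ord2 j) => ->.
    by rewrite (c0 i); exact: cx1.
  by rewrite (c1 i); exact: cy1.
have /derivable1_diffP dc' := dc.
have dfc : differentiable (f \o c) t by exact: differentiable_comp.
apply: DeriveDef; first exact/derivable1_diffP.
rewrite -/(f \o c) deriveE // diff_comp //= diff_partials //.
have -> : 'd c t 1 = pt2 dx dy.
  rewrite -deriveE // derive_mx // [LHS]pt2E !mxE c0 c1.
  by rewrite -cxd -cyd.
by rewrite !mxE.
Qed.

End Coordinates.

(* Derivatives along the two basis vectors are told apart by name only. *)
#[global] Opaque e0 e1.

(** * Rotation-invariant sets and their local graphs *)

Section Rotational.
Context {R : realType}.
Implicit Types (f : 'rV[R]_2 -> R) (S : set 'rV[R]_3) (x y z r : R).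

Definition thrice_differentiable f (u : 'rV[R]_2) :=
  [/\ differentiable f u, forall v, differentiable ('D_v f) u &
      forall v w, differentiable ('D_w ('D_v f)) u].

Lemma local_graph_smooth S p f :
  local_graph S p f -> \forall u \near top_view p, thrice_differentiable f u.
Proof.
move=> [[U [Uo Up [fU dfU]]] _].
apply: (filterS _ (open_nbhs_nbhs (conj Uo Up))) => u Uu; split; first exact: fU.
  by move=> v; have [+ _] := dfU v; apply.
by move=> v w; have [_ /(_ w)[+ _]] := dfU v; apply.
Qed.

Definition rotation_invariant S := forall p q,
  S p -> axis_dist2 p = axis_dist2 q -> zcoord p = zcoord q -> S q.

(** A circle of radius [r] about the axis lies on the surface at height [z], so
    [f(r cos t, r sin t)] is constant near [t = 0]; the two identities say that
    its first and second derivatives vanish there. *)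
Lemma circle_partials S r z f :
  rotation_invariant S -> 0 < r -> S (pt3 r 0 z) ->
  local_graph S (pt3 r 0 z) f ->
  'D_e1 f (pt2 r 0) = 0 /\
  r * 'D_e1 ('D_e1 f) (pt2 r 0) = 'D_e0 f (pt2 r 0).
Proof.
move=> rotS r0 Sp lf; have := local_graph_smooth lf; rewrite coord_pt3 => smooth.
have [_ graph] := lf.
pose c (t : R) := pt2 (r * cos t) (r * sin t).
(* [G] is the derivative of [f] along the circle. *)
pose G (t : R) := - (r * sin t) * 'D_e0 f (c t) + r * cos t * 'D_e1 f (c t).
have dcx (t : R) : is_derive t 1 (fun s : R => r * cos s) (- (r * sin t)).
  by apply: is_derive_eq; rewrite /GRing.scale /=; ring.
have dcy (t : R) : is_derive t 1 (fun s : R => r * sin s) (r * cos t).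
  by apply: is_derive_eq; rewrite /GRing.scale /=; ring.
have cvg_c : c t @[t --> (0 : R)] --> pt2 r 0.
  have -> : pt2 r 0 = c 0 by rewrite /c cos0 sin0 mulr1 mulr0.
  by apply: cvg_pt2; [exact: (is_derive_continuous (dcx 0))
                     |exact: (is_derive_continuous (dcy 0))].
have c0 : c 0 = pt2 r 0 by rewrite /c cos0 sin0 mulr1 mulr0.
have near_smooth : \forall t \near (0 : R), thrice_differentiable f (c t) by exact: cvg_c.
have near_graph : \forall t \near (0 : R), f (c t) - z = 0.
  have : (fun t : R => pt3 (r * cos t) (r * sin t) z) @ (0 : R) --> pt3 r 0 z.
    have -> : pt3 r 0 z = pt3 (r * cos 0) (r * sin 0) z.
      by rewrite cos0 sin0 mulr1 mulr0.
    by apply: cvg_pt3; [exact: (is_derive_continuous (dcx 0))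
                       |exact: (is_derive_continuous (dcy 0))|exact: cvg_cst].
  move=> /(_ _ graph) /= near_graph.
  apply: (@filterS _ (nbhs (0 : R)) _ _ _ _ near_graph) => t /=.
  rewrite !coord_pt3 -/(c t) => <-; first by rewrite subrr.
  apply: (rotS _ _ Sp); rewrite /axis_dist2 !coord_pt3 //.
  by rewrite !exprMn -mulrDr cos2Dsin2 mulr1 expr0n addr0.
have near_G : \forall t \near (0 : R), G t = 0.
  have near_dG : \forall t \near (0 : R), is_derive (t : R) 1 (fun s => f (c s) - z) (G t).
    apply: (filterS _ near_smooth) => t [df _ _].
    have dfc := is_derive_curve (dcx t) (dcy t) df.
    by apply: is_derive_eq; rewrite subr0.
  have near_graphT : \forall t \near (0 : R), [set: R] t -> f (c t) - z = 0.
    by apply: filterS near_graph => t.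
  have := derive_flat (fun s _ => @limit_pointT R s) near_dG near_graphT.
  by apply: filterS => t; exact.
have G0 := nbhs_singleton near_G.
have fy0 : 'D_e1 f (pt2 r 0) = 0.
  move: G0; rewrite /G c0 cos0 sin0 mulr0 oppr0 mul0r add0r mulr1 => /eqP.
  by rewrite mulf_eq0 (gt_eqF r0) => /eqP.
split=> //.
have [_ dfs _] := nbhs_singleton near_smooth.
have dfx := is_derive_curve (dcx 0) (dcy 0) (dfs e0).
have dfy := is_derive_curve (dcx 0) (dcy 0) (dfs e1).
have dG : is_derive (0 : R) 1 G
    (- r * 'D_e0 f (pt2 r 0) + r * (r * 'D_e1 ('D_e1 f) (pt2 r 0))).
  apply: is_derive_eq (is_derive_circle0 r dfx dfy) _.
  rewrite -/(c 0) c0 cos0 sin0 mulr0 oppr0 mulr1.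
  by congr (_ + _ * _); rewrite mul0r add0r.
have near_GT : \forall t \near (0 : R), [set: R] t -> G t = 0.
  by apply: filterS near_G => t.
have [_ /eqP] := derive_limit_zeros dG (@limit_pointT R 0) near_GT.
rewrite mulNr addrC subr_eq0 => /eqP; apply/mulfI; exact: lt0r_neq0.
Qed.

End Rotational.

Section Radii.
Context {R : realType}.
Implicit Types (f : 'rV[R]_2 -> R) (S : set 'rV[R]_3) (x y z r : R).

Lemma isotropic_affineE (s : bool) (h1 h2 c1 c2 c3 : R) b p :
  affine_map (isotropic_mx s h1 h2 c1 c2 c3) b p =
  pt3 ((-1) ^+ s * (h1 * xcoord p - h2 * ycoord p) + xcoord b)
      (h2 * xcoord p + h1 * ycoord p + ycoord b)
      (c1 * xcoord p + c2 * ycoord p + c3 * zcoord p + zcoord b).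
Proof.
rewrite [p in LHS]pt3E [b in LHS]pt3E; apply/rowP => j; rewrite !mxE !big_ord_recr big_ord0 /=.
by rewrite !mxE; case: j => [[|[|[|[]]]]] //= _; ring.
Qed.

Lemma polar_angle x y : x ^+ 2 + y ^+ 2 = 1 -> exists t, cos t = x /\ sin t = y.
Proof.
move=> xy1.
have x1 : -1 <= x <= 1 by apply/andP; split; nra.
have cosx : cos (acos x) = x by rewrite acosK ?in_itv.
have sinx : sin (acos x) = `|y|.
  by rewrite sin_acos// -xy1 addrC addKr sqrtr_sqr.
case: (lerP 0 y) => y0; first by exists (acos x); rewrite sinx ger0_norm.
by exists (- acos x); rewrite cosN sinN sinx ltr0_norm ?opprK.
Qed.

(** A rotation between two points at the same distance from the axis is given by
    the normalized scalar and cross products of their top views. *)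
Lemma z_rotation_invariant S :
  (forall t, z_rotation t @` S = S) -> rotation_invariant S.
Proof.
move=> rotS p q Sp; set d := axis_dist2 p => pq zpq.
have [t [tcos tsin]] : exists t, cos t * xcoord p - sin t * ycoord p = xcoord q /\
    sin t * xcoord p + cos t * ycoord p = ycoord q.
  have [d0|d0] := eqVneq d 0.
    exists 0; move: (d0) (d0); rewrite {2}pq /d /axis_dist2.
    move=> /eqP; rewrite paddr_eq0 ?sqr_ge0// !sqrf_eq0 => /andP[/eqP-> /eqP->].
    move=> /eqP; rewrite paddr_eq0 ?sqr_ge0// !sqrf_eq0 => /andP[/eqP-> /eqP->].
    by rewrite cos0 sin0; split; ring.
  have norm1 : ((xcoord p * xcoord q + ycoord p * ycoord q) / d) ^+ 2 +
      ((xcoord p * ycoord q - ycoord p * xcoord q) / d) ^+ 2 = 1.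
    apply: (@mulIf _ (d ^+ 2)); first by rewrite expf_neq0.
    rewrite mul1r [in RHS]expr2 {5}pq mulrDl -!exprMn !divfK//.
    by rewrite /d /axis_dist2; ring.
  have [t [tc ts]] := polar_angle norm1.
  exists t; rewrite tc ts; move: d0; rewrite /d /axis_dist2 => d0.
  by split; field.
have coord0 : (xcoord 0 = 0 :> R) * (ycoord 0 = 0 :> R) * (zcoord 0 = 0 :> R).
  by rewrite /xcoord /ycoord /zcoord !mxE.
rewrite -(rotS t); exists p => //.
rewrite /z_rotation isotropic_affineE [RHS]pt3E -tcos -tsin !coord0 -zpq expr0.
by congr pt3; ring.
Qed.

End Radii.

(** * The radii of a rotation-invariant surface fill intervals *)

Section ChartRadii.
Context {R : realType}.
Implicit Types (f : 'rV[R]_2 -> R) (S : set 'rV[R]_3) (r : R).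

Definition radius (p : 'rV[R]_3) : R := Num.sqrt (axis_dist2 p).

(** The point of the half-plane [y = 0 <= x] on the horizontal circle through [p]. *)
Definition profile (p : 'rV[R]_3) : 'rV[R]_3 := pt3 (radius p) 0 (zcoord p).

Lemma radius_ge0 p : 0 <= radius p. Proof. exact: sqrtr_ge0. Qed.

Lemma axis_dist2_ge0 (p : 'rV[R]_3) : 0 <= axis_dist2 p.
Proof. by rewrite addr_ge0 ?sqr_ge0. Qed.

Lemma sqr_radius p : radius p ^+ 2 = axis_dist2 p.
Proof. exact/sqr_sqrtr/axis_dist2_ge0. Qed.

Lemma axis_dist2_pt3 x y z : axis_dist2 (pt3 x y z) = x ^+ 2 + y ^+ 2 :> R.
Proof. by rewrite /axis_dist2 !coord_pt3. Qed.

Lemma radius_pt3 r (z : R) : 0 <= r -> radius (pt3 r 0 z) = r.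
Proof. by move=> r0; rewrite /radius axis_dist2_pt3 expr0n addr0 sqrtr_sqr ger0_norm. Qed.

Lemma profile_pt3 r z : 0 <= r -> profile (pt3 r 0 z) = pt3 r 0 z.
Proof. by move=> r0; rewrite /profile radius_pt3 // coord_pt3. Qed.

Lemma profile_in S p : rotation_invariant S -> S p -> S (profile p).
Proof.
move=> rotS Sp; apply: (rotS _ _ Sp); last by rewrite coord_pt3.
by rewrite axis_dist2_pt3 expr0n addr0 sqr_radius.
Qed.

Lemma radius_continuous : continuous radius.
Proof.
move=> p; apply: continuous_comp; last exact: sqrt_continuous.
have cx : {for p, continuous (@xcoord R)} by exact: (@coord_continuous R 1 3).
have cy : {for p, continuous (@ycoord R)} by exact: (@coord_continuous R 1 3).
have -> : @axis_dist2 R = (@xcoord R \* @xcoord R) + (@ycoord R \* @ycoord R).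
  by apply/funext => q; rewrite fctE /axis_dist2 !expr2.
exact: (cvgD (cvgM cx cx) (cvgM cy cy)).
Qed.

Lemma profile_continuous : continuous profile.
Proof.
move=> p; exact: (cvg_pt3 (@radius_continuous p) (@cvg_cst _ _ _ _ _)
  (@coord_continuous R 1 3 0 2 p)).
Qed.

Lemma coord_mx_differentiable (psi : 'rV[R]_2 -> 'rV[R]_3) u j :
  differentiable psi u -> differentiable (fun w => psi w 0 j) u.
Proof.
move=> dpsi.
exact: (differentiable_comp dpsi (@differentiable_coord R 1 3 (psi u) 0 j)).
Qed.

(** If the radius did not vary on the patch [psi] then all tangent vectors at
    [p = psi u], which lies in the half-plane [y = 0 <= x], would be orthogonal
    to the x-axis; the graph [z = f(x, y)] carries only a line of those. *)
Lemma chart_radius_not_constant (psi : 'rV[R]_2 -> 'rV[R]_3) u r z f (B : set 'rV[R]_2) :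
  0 <= r -> psi u = pt3 r 0 z ->
  differentiable psi u -> injective ('d psi u) -> differentiable f (pt2 r 0) ->
  (\forall w \near u, half_plane w -> B w) -> half_plane u ->
  (forall w, B w -> zcoord (psi w) = f (top_view (psi w))) ->
  ~ (forall w, B w -> radius (psi w) = r).
Proof.
move=> r0 psiu dpsi inj df Bu Hu graph radB.
pose X w := psi w 0 0; pose Y w := psi w 0 1; pose Z w := psi w 0 2.
have dX : differentiable X u by exact: coord_mx_differentiable.
have dY : differentiable Y u by exact: coord_mx_differentiable.
have dZ : differentiable Z u by exact: coord_mx_differentiable.
have Xu : X u = r by rewrite /X -/(xcoord _) psiu coord_pt3.
have Yu : Y u = 0 by rewrite /Y -/(ycoord _) psiu coord_pt3.
pose D g (v : R * R) := v.1 * 'D_e0 g u + v.2 * 'D_e1 g u.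
(* At a boundary point only the positive direction of [v] stays in the
   half-plane; [(1, 0)] and [(0, 1)] are directions of this kind. *)
have key (v : R * R) : 0 <= v.1 ->
    D X v = 0 /\ D Z v = 'D_e1 f (pt2 r 0) * D Y v.
  move=> v0.
  pose cx (t : R) := u 0 0 + v.1 * t; pose cy (t : R) := u 0 1 + v.2 * t.
  have dcx (t : R) : is_derive t 1 cx v.1.
    by apply: is_derive_eq; rewrite /GRing.scale /=; ring.
  have dcy (t : R) : is_derive t 1 cy v.2.
    by apply: is_derive_eq; rewrite /GRing.scale /=; ring.
  have c0 : pt2 (cx 0) (cy 0) = u by rewrite /cx /cy !mulr0 !addr0 -pt2E.
  have dalong g : differentiable g u ->
      is_derive (0 : R) 1 (fun t => g (pt2 (cx t) (cy t))) (D g v).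
    by move=> dg; have := is_derive_curve (dcx 0) (dcy 0); rewrite c0; exact.
  have nearB : \forall t \near (0 : R), 0 < t -> B (pt2 (cx t) (cy t)).
    have : pt2 (cx t) (cy t) @[t --> (0 : R)] --> u.
      rewrite -[X in _ --> X]c0.
      by apply: cvg_pt2; [exact: (is_derive_continuous (dcx 0))
                         |exact: (is_derive_continuous (dcy 0))].
    move=> /(_ _ Bu) /= nearB.
    apply: (@filterS _ (nbhs (0 : R)) _ _ _ _ nearB) => t /= + t0; apply.
    by rewrite /half_plane /= mxE /=; rewrite addr_ge0 // mulr_ge0 // ltW.
  have zero (g : 'rV[R]_2 -> R) (d : R) :
      is_derive (0 : R) 1 (fun t => g (pt2 (cx t) (cy t))) d ->
      (forall w, B w -> g w = 0) -> d = 0.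
    move=> dg g0; apply: (proj2 (derive_limit_zeros dg limit_point_pos _)).
    by apply: filterS nearB => t + t0 => /(_ t0); exact: g0.
  have XY w : B w -> X w ^+ 2 + Y w ^+ 2 = r ^+ 2.
    by move=> Bw; rewrite -(radB _ Bw) sqr_radius.
  have DX : D X v = 0.
    have [r00|rn0] := eqVneq r 0.
      apply: (zero X _ (dalong _ dX)) => w /XY /eqP.
      by rewrite r00 expr0n /= paddr_eq0 ?sqr_ge0// !sqrf_eq0 => /andP[/eqP].
    have dXs := dalong _ dX; have dYs := dalong _ dY.
    have /eqP : r * D X v + r * D X v = 0.
      apply: (zero (fun w => X w * X w + Y w * Y w - r ^+ 2)); last first.
        by move=> w Bw; rewrite -!expr2 XY // subrr.
      have dXXYY := is_deriveB (is_deriveD (is_deriveM dXs dXs) (is_deriveM dYs dYs))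
        (is_derive_cst (r ^+ 2) (0 : R) (1 : R)).
      apply: is_derive_eq dXXYY _.
      by rewrite c0 Xu Yu /GRing.scale /= !mul0r !addr0 subr0.
    rewrite -mulr2n mulrn_eq0 /= mulf_eq0 (negPf rn0) => /eqP; exact.
  split=> //.
  have dfXY : is_derive (0 : R) 1
      (fun t => f (pt2 (X (pt2 (cx t) (cy t))) (Y (pt2 (cx t) (cy t)))))
      (D X v * 'D_e0 f (pt2 r 0) + D Y v * 'D_e1 f (pt2 r 0)).
    have := is_derive_curve (dalong _ dX) (dalong _ dY).
    by rewrite c0 Xu Yu; exact.
  have : D Z v - (D X v * 'D_e0 f (pt2 r 0) + D Y v * 'D_e1 f (pt2 r 0)) = 0.
    apply: (zero (fun w => Z w - f (pt2 (X w) (Y w)))).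
      exact: is_deriveB (dalong _ dZ) dfXY.
    by move=> w Bw; rewrite [Z w](graph w Bw) subrr.
  by rewrite DX mul0r add0r => /eqP; rewrite subr_eq0 mulrC => /eqP.
have [x0 [y0 [z0 [x1 [y1 [z1]]]]]] : exists x0 y0 z0 x1 y1 z1,
    [/\ D X (1, 0) = x0, D Y (1, 0) = y0, D Z (1, 0) = z0 &
    [/\ D X (0, 1) = x1, D Y (0, 1) = y1, D Z (0, 1) = z1 &
    forall a b, 'd psi u (pt2 a b) =
      pt3 (a * x0 + b * x1) (a * y0 + b * y1) (a * z0 + b * z1)]].
  have Dpsi v : 'D_v psi u = pt3 ('D_v X u) ('D_v Y u) ('D_v Z u).
    rewrite derive_mx; last exact: diff_derivable.
    by rewrite [LHS]pt3E /xcoord /ycoord /zcoord !mxE.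
  have D10 g : D g (1, 0) = 'D_e0 g u by rewrite /D mul1r mul0r addr0.
  have D01 g : D g (0, 1) = 'D_e1 g u by rewrite /D mul1r mul0r add0r.
  exists ('D_e0 X u), ('D_e0 Y u), ('D_e0 Z u).
  exists ('D_e1 X u), ('D_e1 Y u), ('D_e1 Z u).
  split; [exact: D10|exact: D10|exact: D10|].
  split; [exact: D01|exact: D01|exact: D01|move=> a b].
  by rewrite (diff_partials _ dpsi) !Dpsi !mxE pt3_lincomb.
have [+ +] := key (1, 0) ler01; have [+ +] := key (0, 1) (lexx 0).
move: (D X) (D Y) (D Z) ('D_e1 f (pt2 r 0)) inj => DX DY DZ k inj.
move=> X1 Z1 X0 Z0 [Dx0 Dy0 Dz0 [Dx1 Dy1 Dz1 dpsiE]].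
have ker (a b : R) : a * y0 + b * y1 = 0 -> a = 0 /\ b = 0.
  move=> ab0.
  have : 'd psi u (pt2 a b) = 'd psi u 0.
    rewrite linear0 dpsiE -Dx0 -Dx1 -Dz0 -Dz1 X0 X1 Z0 Z1 Dy0 Dy1.
    have -> : a * (k * y0) + b * (k * y1) = k * (a * y0 + b * y1) by ring.
    rewrite ab0 !mulr0 addr0; apply/rowP => j.
    by rewrite !mxE; case: j => [[|[|[|[]]]]].
  move=> /inj ab; split.
    by have := congr1 (fun w : 'rV[R]_2 => w 0 0) ab; rewrite !mxE.
  by have := congr1 (fun w : 'rV[R]_2 => w 0 1) ab; rewrite !mxE.
(* [y1 e0 - y0 e1] is always in the kernel. *)
have [|y10 /eqP] := ker y1 (- y0); first by rewrite mulNr mulrC subrr.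
rewrite oppr_eq0 => /eqP y00.
have [|/eqP] := ker 1 0; first by rewrite y00 y10 !mulr0 addr0.
by rewrite oner_eq0.
Qed.

End ChartRadii.

Section RadiiInterval.
Context {R : realType}.
Implicit Types (f : 'rV[R]_2 -> R) (S : set 'rV[R]_3) (r z : R).

(** [J] is the set of radii of a small patch of [S] around [(r, 0, z)]: an
    interval even at a boundary point, and all of it is realized on the profile
    inside the prescribed neighbourhood [V]. *)
Definition radii_near S r z (V : set 'rV[R]_3) (J : set R) :=
  [/\ is_interval J, J r, exists2 s, J s & s != r,
      forall s, J s -> 0 <= s /\ exists2 y, S (pt3 s 0 y) & V (pt3 s 0 y) &
      \forall q \near pt3 r 0 z, S q -> J (radius q)].

Lemma chart_class_C_continuous (psi : 'rV[R]_2 -> 'rV[R]_3) W u :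
  class_C 3 W psi -> W u -> {for u, continuous psi}.
Proof. by move=> [dpsi _] /dpsi; exact: differentiable_continuous. Qed.

(** The patch is the image of a half-ball of a chart. The half-ball is convex, so
    its radii form an interval; the chart is a homeomorphism onto a relatively
    open set, so near [(r, 0, z)] the set [S] contains no other points. *)
Lemma radii_interval S r z f V :
  surface S -> rotation_invariant S -> 0 <= r -> S (pt3 r 0 z) ->
  local_graph S (pt3 r 0 z) f -> nbhs (pt3 r 0 z) V ->
  exists J, radii_near S r z V J.
Proof.
move=> [_ charts] rotS r0 Sp lf Vp.
have [W [psi [psi_chart [u [Wu Hu] psiu]]]] := charts _ Sp.
have [Wo psiC psi_inj [Q [g [Qo psiQ gK gc]]]] := psi_chart.
have [_ graph] := lf.
have near_u : \forall w \near u, [/\ W w, V (profile (psi w)) &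
    S (psi w) -> zcoord (psi w) = f (top_view (psi w))].
  have psi_u : psi w @[w --> u] --> pt3 r 0 z.
    by rewrite -psiu; exact: chart_class_C_continuous psiC Wu.
  have prof_u : profile (psi w) @[w --> u] --> pt3 r 0 z.
    rewrite -[X in _ --> X](profile_pt3 _ r0).
    exact: (cvg_comp _ _ psi_u (@profile_continuous R (pt3 r 0 z))).
  near=> w; split.
  - by near: w; exact: open_nbhs_nbhs (conj Wo Wu).
  - by near: w; exact: prof_u Vp.
  - by near: w; exact: psi_u graph.
have [e /= e0 ball_e] := (nbhs_ballP _ _).1 near_u.
pose B := ball u e `&` half_plane.
have WB w : B w -> W w by move=> [/ball_e[]].
have SB w : B w -> S (psi w).
  move=> Bw; have : (psi @` (W `&` half_plane)) (psi w).
    by exists w => //; split; [exact: WB|exact: Bw.2].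
  by rewrite psiQ => -[].
have Bu : B u by split=> //; exact: ballxx.
exists [set radius (psi w) | w in B]; split.
- move=> _ _ /= [w1 [Bw1 Hw1] <-] [w2 [Bw2 Hw2] <-] s /andP[ws sw].
  pose c (t : R) := w1 + t *: (w2 - w1).
  have Bc t : 0 <= t <= 1 -> B (c t).
    move=> /andP[t0 t1]; split; last first.
      rewrite /half_plane /= !mxE.
      have -> : w1 0 0 + t * (w2 0 0 - w1 0 0) = (1 - t) * w1 0 0 + t * w2 0 0 by ring.
      by rewrite addr_ge0// mulr_ge0// subr_ge0.
    move: Bw1 Bw2; rewrite -ball_normE /= => Bw1 Bw2.
    have -> : u - c t = (1 - t) *: (u - w1) + t *: (u - w2).
      by apply/rowP => j; rewrite !mxE; ring.
    apply: (le_lt_trans (ler_normD _ _)); rewrite !normrZ !ger0_norm ?subr_ge0//.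
    have [->|tn0] := eqVneq t 0; first by rewrite subr0 mul1r mul0r addr0.
    have {tn0}t0' : 0 < t by rewrite lt0r tn0.
    have -> : e = (1 - t) * e + t * e by ring.
    by rewrite ler_ltD// ?ler_wpM2l ?subr_ge0 ?(ltW Bw1)// ltr_pM2l.
  have cc : continuous c.
    move=> t; apply: cvgD; first exact: cvg_cst.
    by apply: cvgZr_tmp; exact: cvg_id.
  have cont : {within `[0, 1], continuous (fun t => radius (psi (c t)))}.
    apply: continuous_in_subspaceT => t; rewrite inE /= in_itv /= => /Bc/WB Wt.
    exact: (continuous_comp (cc t) (continuous_comp
      (chart_class_C_continuous psiC Wt) (@radius_continuous R _))).
  have c0 : c 0 = w1 by rewrite /c scale0r addr0.
  have c1 : c 1 = w2 by rewrite /c scale1r addrC subrK.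
  have [|t + <-] := @IVT _ _ 0 1 s ler01 cont.
    rewrite c0 c1 (min_idPl _) ?(max_idPr _) ?ws//; exact: le_trans sw.
  by rewrite in_itv /= => /Bc Bt; exists (c t).
- by exists u => //; rewrite psiu radius_pt3.
- have [//|const] := pselect (exists2 s, [set radius (psi w) | w in B] s & s != r).
  have [dpsi _] := psiC.
  exfalso; apply: (@chart_radius_not_constant R psi u r z f B) => //.
  + exact: dpsi.
  + exact: psi_inj.
  + by have [+ _ _] := nbhs_singleton (local_graph_smooth lf); rewrite coord_pt3.
  + near=> w => Hw; split => //; near: w; apply/nbhs_ballP; by exists e.
  + by move=> w Bw; have [/ball_e[_ _ +] _] := Bw; apply; exact: SB.
  + move=> w Bw; apply: contrapT => /eqP wr.
    by apply: const; exists (radius (psi w)) => //; exists w.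
- move=> _ [w Bw <-]; split; first exact: radius_ge0.
  exists (zcoord (psi w)); first exact: profile_in (SB _ Bw).
  by have [/ball_e[_ + _] _] := Bw.
- have Qp : Q (pt3 r 0 z).
    have : (psi @` (W `&` half_plane)) (pt3 r 0 z) by exists u.
    by rewrite psiQ => -[].
  have gp : g (pt3 r 0 z) = u by rewrite -psiu gK.
  have near_g : \forall q \near pt3 r 0 z, (S `&` Q) q -> ball u e (g q).
    have : nbhs (g (pt3 r 0 z)) (ball u e) by rewrite gp; exact: nbhsx_ballx.
    move=> /(gc (pt3 r 0 z)).
    by rewrite /= /nbhs /= -nbhs_subspace_in.
  have near_Q : \forall q \near pt3 r 0 z, Q q by exact: open_nbhs_nbhs (conj Qo Qp).
  near=> q => Sq.
  have SOq : (S `&` Q) q by split=> //; near: q.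
  have : ball u e (g q) by move: (SOq); near: q.
  move: (SOq); rewrite -psiQ => -[w [Ww Hw] <-].
  by rewrite gK// => Bw; exists w.
Unshelve. all: by end_near. Qed.

End RadiiInterval.

(** * Characteristic polynomials of size two and the profiles of the models *)

Section CharPoly2.
Context {R : realType}.
Implicit Types (A : 'M[R]_2).

Lemma det_mx22 (T : comNzRingType) (A : 'M[T]_2) :
  \det A = A 0 0 * A 1 1 - A 0 1 * A 1 0.
Proof.
rewrite (expand_det_row _ 0) !big_ord_recl big_ord0 addr0 /cofactor !det_mx11 !mxE /=.
rewrite expr0 expr1 mul1r mulN1r mulrN.
by congr (_ * A _ _ - A _ _ * A _ _); apply/val_inj.
Qed.

Lemma char_poly2P A (k1 k2 : R) :
  char_poly A = ('X - k1%:P) * ('X - k2%:P) <->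
  k1 + k2 = A 0 0 + A 1 1 /\ k1 * k2 = A 0 0 * A 1 1 - A 0 1 * A 1 0.
Proof.
have -> : char_poly A =
    'X ^+ 2 - (A 0 0 + A 1 1)%:P * 'X + (A 0 0 * A 1 1 - A 0 1 * A 1 0)%:P.
  rewrite /char_poly det_mx22 !mxE /= mulr1n mulr0n !sub0r.
  by rewrite polyCB polyCD !polyCM; ring.
have -> : ('X - k1%:P) * ('X - k2%:P) = 'X ^+ 2 - (k1 + k2)%:P * 'X + (k1 * k2)%:P.
  by rewrite polyCD polyCM; ring.
split=> [eqp|[-> ->]//].
have eq0 := congr1 (fun p => p.[0]) eqp; have eq1 := congr1 (fun p => p.[1]) eqp.
rewrite !hornerE /= in eq0 eq1.
by split; lra.
Qed.

End CharPoly2.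

Section ModelProfile.
Context {R : realType}.
Implicit Types (e s r : R) (J : set R).

(** As functions of [s = x^2 + y^2] these are the heights of the model surfaces,
    [e] being the ratio of the radial to the circular curvature. The two branches
    of [model_fun] share the derivative [s^((e - 1) / 2)] up to a constant. *)
Definition model_fun e s : R := if e == -1 then ln s else s `^ ((1 + e) / 2).
Definition model_slope e s : R :=
  (if e == -1 then 1 else (1 + e) / 2) * s `^ ((e - 1) / 2).

Lemma is_derive_model_fun e s : 0 < s ->
  is_derive s 1 (model_fun e) (model_slope e s).
Proof.
move=> s0; rewrite /model_fun /model_slope; case: eqVneq => [->|e1].
  have -> : (-1 - 1) / 2 = -1 :> R by field.
  by rewrite powR_inv1 ?ltW// mul1r; exact: is_derive1_ln.
have -> : (e - 1) / 2 = (1 + e) / 2 - 1 by field.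
exact: is_derive1_powR.
Qed.

Lemma is_derive_model_slope e s : 0 < s ->
  is_derive s 1 (model_slope e) ((e - 1) / 2 * model_slope e s / s).
Proof.
move=> s0; rewrite /model_slope; set c := (if _ then _ else _).
have ds := is_deriveZ c (is_derive1_powR ((e - 1) / 2) s0).
apply: is_derive_eq ds _; rewrite /GRing.scale /= powRB ?powRr1 ?ltW//; last first.
  by rewrite (gt_eqF s0) implybT.
by move: (_ `^ _) c => q c; field; exact: lt0r_neq0.
Qed.

Lemma model_slope_neq0 e s : 0 < s -> model_slope e s != 0.
Proof.
move=> s0; apply: mulf_neq0; last by rewrite gt_eqF ?powR_gt0.
case: ifPn => [_|e1]; first exact: oner_neq0.
by rewrite mulf_neq0 ?invr_neq0 ?pnatr_eq0// addrC addr_eq0.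
Qed.

Lemma model_fun1 s : 0 <= s -> model_fun 1 s = s.
Proof.
move=> s0; rewrite /model_fun -subr_eq0 opprK -[_ + _ == 0]/(2%:R == 0 :> R).
rewrite pnatr_eq0 /= divff ?powRr1//; exact: pnatr_eq0.
Qed.

Lemma is_derive_sqr r : is_derive r 1 (fun t : R => t ^+ 2) (2 * r).
Proof.
have -> : (fun t : R => t ^+ 2) = (fun t => t * t).
  by apply/funext => t; rewrite expr2.
apply: is_derive_eq (is_deriveM (is_derive_id r 1) (is_derive_id r 1)) _.
by rewrite /GRing.scale /=; ring.
Qed.

Lemma is_derive_model_sqr e r : 0 < r ->
  is_derive r 1 (fun t => model_fun e (t ^+ 2)) (2 * r * model_slope e (r ^+ 2)).
Proof.
move=> r0; rewrite mulrC; apply: is_derive1_comp (is_derive_sqr r).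
by apply: is_derive_model_fun; rewrite exprn_gt0.
Qed.

Lemma is_derive_model_slope_sqr e r : 0 < r ->
  is_derive r 1 (fun t => 2 * t * model_slope e (t ^+ 2))
    (2 * e * model_slope e (r ^+ 2)).
Proof.
move=> r0; have r20 : 0 < r ^+ 2 by rewrite exprn_gt0.
have dM := @is_derive1_comp R (model_slope e) (fun t => t ^+ 2) r _ _
  (is_derive_model_slope e r20) (is_derive_sqr r).
have d2 : is_derive r 1 (fun t : R => 2 * t) 2.
  apply: is_derive_eq (is_deriveZ 2 (is_derive_id r 1)) _.
  by rewrite /GRing.scale /= mulr1.
apply: is_derive_eq (is_deriveM d2 dM) _.
rewrite /GRing.scale /=; move: (model_slope e (r ^+ 2)) => M.
by field; exact: lt0r_neq0.
Qed.

(** Both [h] and the model profile have derivatives solving the same linear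
    equation [r y' = e y], hence proportional ones. *)
Lemma profile_ode J e (h h1 h2 : R -> R) j :
  is_interval J -> J j -> (forall r, J r -> 0 < r) ->
  (forall r, J r -> is_derive r 1 h (h1 r)) ->
  (forall r, J r -> is_derive r 1 h1 (h2 r)) ->
  (forall r, J r -> h1 r != 0 /\ r * h2 r = e * h1 r) ->
  exists C D, C != 0 /\ forall r, J r -> h r = C * model_fun e (r ^+ 2) + D.
Proof.
move=> Jitv Jj J0 dh dh1 ode.
pose m1 (r : R) := 2 * r * model_slope e (r ^+ 2).
have m1n0 r : J r -> m1 r != 0.
  move=> /J0 r0; apply: mulf_neq0; last by rewrite model_slope_neq0 ?exprn_gt0.
  by rewrite mulf_neq0 ?lt0r_neq0.
pose C := h1 j / m1 j.
have h1E r : J r -> h1 r = C * m1 r.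
  move=> Jr; apply: (canRL (divfK (m1n0 _ Jr))).
  apply: (@is_derive0_interval_cst R (fun t => h1 t / m1 t) J Jitv _ r j Jr Jj).
  move=> s Js; have s0 := J0 _ Js; have [_ ode_s] := ode _ Js.
  have dm1 := is_derive_model_slope_sqr e s0; rewrite -/m1 in dm1.
  have dinv := is_deriveV (m1n0 _ Js) dm1.
  apply: is_derive_eq (is_deriveM (dh1 _ Js) dinv) _.
  have prop : h2 s * m1 s = h1 s * (2 * e * model_slope e (s ^+ 2)).
    rewrite /m1; move: (model_slope _ _) (h1 s) (h2 s) ode_s => M x y E.
    by transitivity (2 * M * (s * y)); [|rewrite E]; ring.
  rewrite /GRing.scale /=; move: (m1n0 _ Js) prop.
  move: (m1 s) (model_slope _ _) (h1 s) (h2 s) => m M x y mn0 prop.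
  have -> : x * (- m ^- 2 * (2 * e * M)) = - (x * (2 * e * M)) / m ^+ 2 by field.
  by rewrite -prop; field.
have C0 : C != 0.
  by rewrite mulf_neq0 ?invr_neq0 ?m1n0//; have [] := ode _ Jj.
exists C, (h j - C * model_fun e (j ^+ 2)); split=> // r Jr.
have cst : h r - C * model_fun e (r ^+ 2) = h j - C * model_fun e (j ^+ 2).
  apply: (@is_derive0_interval_cst R (fun t => h t - C * model_fun e (t ^+ 2))
    J Jitv _ r j Jr Jj) => s Js.
  have dm := is_deriveZ C (is_derive_model_sqr e (J0 _ Js)).
  apply: is_derive_eq (is_deriveB (dh _ Js) dm) _.
  by rewrite h1E // /m1 /GRing.scale /= subrr.
by rewrite -cst addrC subrK.
Qed.

End ModelProfile.

(** * Hessians along the profile *)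

Section LocalProfile.
Context {R : realType}.
Implicit Types (f g : 'rV[R]_2 -> R) (S : set 'rV[R]_3) (r s z : R) (J : set R).

(** Being a local graph is an open condition, so a single [f] serves all points of
    [S] near [p]. *)
Lemma local_graph_near S p f :
  local_graph S p f -> \forall q \near p, local_graph S q f.
Proof.
move=> [[U [Uo Up fC]] graph].
have near_U : \forall q \near p, U (top_view q).
  exact: (top_view_continuous (open_nbhs_nbhs (conj Uo Up))).
have near_graph := near_join graph.
near=> q; split; last by near: q.
by exists U; split => //; near: q.
Unshelve. all: by end_near. Qed.

Lemma local_graph_eq S p f : local_graph S p f -> S p -> zcoord p = f (top_view p).
Proof. by move=> [_ /nbhs_singleton]. Qed.

Lemma local_graph_smooth_axis S r z f : local_graph S (pt3 r 0 z) f ->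
  \forall s \near r, thrice_differentiable f (pt2 s 0).
Proof.
move=> /local_graph_smooth; rewrite coord_pt3 => smooth.
have axis_r : pt2 s 0 @[s --> r] --> pt2 r 0.
  by apply: cvg_pt2; [exact: cvg_id|exact: cvg_cst].
exact: (axis_r _ smooth).
Qed.

Lemma is_derive_axis f r : differentiable f (pt2 r 0) ->
  is_derive r 1 (fun s => f (pt2 s 0)) ('D_e0 f (pt2 r 0)).
Proof.
move=> df.
have := is_derive_curve (is_derive_id r (1 : R)) (is_derive_cst (0 : R) r (1 : R)) df.
by rewrite mul1r mul0r addr0.
Qed.

Lemma char_poly_hessian f u (f00 f11 f01 f10 k1 k2 : R) :
  'D_e0 ('D_e0 f) u = f00 -> 'D_e1 ('D_e1 f) u = f11 ->
  'D_e0 ('D_e1 f) u = f01 -> 'D_e1 ('D_e0 f) u = f10 ->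
  char_poly (hessian f u) = ('X - k1%:P) * ('X - k2%:P) <->
  k1 + k2 = f00 + f11 /\ k1 * k2 = f00 * f11 - f01 * f10.
Proof.
have hE i j : hessian f u i j =
  'D_(delta_mx 0 i) ('D_(delta_mx 0 j) f) u by rewrite mxE.
move=> <- <- <- <-.
by have := @char_poly2P R (hessian f u) k1 k2; rewrite !hE.
Qed.

Lemma is_derive_axisB f g r : differentiable f (pt2 r 0) -> differentiable g (pt2 r 0) ->
  is_derive r 1 (fun s => f (pt2 s 0) - g (pt2 s 0))
    ('D_e0 f (pt2 r 0) - 'D_e0 g (pt2 r 0)).
Proof. by move=> /is_derive_axis df /is_derive_axis dg; exact: is_deriveB. Qed.

(** The unordered pairs [{k1, k2}] and [{x, y}] coincide, and the ratio of [x] to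
    [y] is one of the two ratios of [k1] and [k2]. *)
Lemma ratio_of_diagonal (a k1 k2 x y : R) :
  a != 0 -> k1 + k2 = x + y -> k1 * k2 = x * y -> k1 * k2 != 0 ->
  k1 / k2 = a \/ k2 / k1 = a -> y != 0 /\ (x = a * y \/ x = a^-1 * y).
Proof.
move=> a0 sum prod; rewrite mulf_eq0 negb_or => /andP[k10 k20] ratio.
have : (k1 - x) * (k1 - y) = 0.
  have -> : (k1 - x) * (k1 - y) = k1 ^+ 2 - (x + y) * k1 + x * y by ring.
  by rewrite -sum -prod; ring.
move=> /eqP; rewrite mulf_eq0 !subr_eq0 => /orP[] /eqP xy.
  have yk2 : y = k2 by apply: (addrI x); rewrite -sum xy.
  rewrite -xy yk2; split=> //; case: ratio => <-; [left|right]; by field; rewrite ?k10 ?k20.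
have xk2 : x = k2 by apply: (addIr y); rewrite -sum xy addrC.
rewrite -xy xk2; split=> //; case: ratio => <-; [right|left]; by field; rewrite ?k10 ?k20.
Qed.

(** With [D_0 D_1 f = 0] the Hessian is triangular, so its diagonal consists of
    the principal curvatures. *)
Lemma curvatures_of_triangular f u (k1 k2 : R) :
  char_poly (hessian f u) = ('X - k1%:P) * ('X - k2%:P) ->
  'D_e0 ('D_e1 f) u = 0 -> exists x y,
  [/\ 'D_e0 ('D_e0 f) u = x, 'D_e1 ('D_e1 f) u = y, k1 + k2 = x + y & k1 * k2 = x * y].
Proof.
move E00 : ('D_e0 ('D_e0 f) u) => x; move E11 : ('D_e1 ('D_e1 f) u) => y.
move=> + f01; move E10 : ('D_e1 ('D_e0 f) u) => z.
move=> /(char_poly_hessian _ _ E00 E11 f01 E10)[sum]; rewrite mul0r subr0 => prod.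
by exists x, y.
Qed.

Lemma ratio_off_axis (a k1 k2 s : R) f u :
  a != 0 -> k1 * k2 != 0 -> k1 / k2 = a \/ k2 / k1 = a ->
  char_poly (hessian f u) = ('X - k1%:P) * ('X - k2%:P) ->
  0 < s -> 'D_e0 ('D_e1 f) u = 0 -> s * 'D_e1 ('D_e1 f) u = 'D_e0 f u ->
  'D_e0 f u != 0 /\ (s * 'D_e0 ('D_e0 f) u = a * 'D_e0 f u \/
                     s * 'D_e0 ('D_e0 f) u = a^-1 * 'D_e0 f u).
Proof.
move=> a0 k0 ratio char s0 f01 f11.
have [x [y [-> fyy sum prod]]] := curvatures_of_triangular char f01.
rewrite -f11 fyy; have [y0 xy] := ratio_of_diagonal a0 sum prod k0 ratio.
split; first exact: mulf_neq0 (lt0r_neq0 s0) y0.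
by case: xy => ->; [left|right]; rewrite mulrCA.
Qed.

Lemma ratio_on_axis (a k1 k2 : R) f u :
  a != 0 -> k1 * k2 != 0 -> k1 / k2 = a \/ k2 / k1 = a ->
  char_poly (hessian f u) = ('X - k1%:P) * ('X - k2%:P) ->
  'D_e0 ('D_e1 f) u = 0 -> 'D_e1 ('D_e1 f) u = 'D_e0 ('D_e0 f) u -> a = 1.
Proof.
move=> a0 k0 ratio char f01 f11.
have [x [y [fxx fyy sum prod]]] := curvatures_of_triangular char f01.
have yx : y = x by rewrite -fyy f11.
have [y0 xy] := ratio_of_diagonal a0 sum prod k0 ratio; rewrite yx in y0 xy.
have [//|a1] : a = 1 \/ a^-1 = 1.
  by case: xy => E; [left|right]; apply: (mulIf y0); rewrite mul1r -E.
by rewrite -[a]invrK a1 invr1.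
Qed.

(** The identities of [circle_partials] hold along the profile, where radii
    accumulate at [r]; they can therefore be differentiated once more in the
    radial direction at [r]. At [r = 0] this makes the two diagonal entries of
    the Hessian equal. *)
Lemma profile_hessian S J (h : R -> R) r g :
  rotation_invariant S ->
  (forall s, J s -> 0 < s /\ S (pt3 s 0 (h s))) ->
  limit_point J r -> {for r, continuous h} ->
  local_graph S (pt3 r 0 (h r)) g ->
  [/\ \forall s \near r, J s -> h s - g (pt2 s 0) = 0,
      'D_e0 ('D_e1 g) (pt2 r 0) = 0 &
      r = 0 -> 'D_e1 ('D_e1 g) (pt2 0 0) = 'D_e0 ('D_e0 g) (pt2 0 0)].
Proof.
move=> rotS Jh Jr hr lg.
have near_lg : \forall s \near r, local_graph S (pt3 s 0 (h s)) g.
  have /(_ _ (local_graph_near lg)) : pt3 s 0 (h s) @[s --> r] --> pt3 r 0 (h r).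
    by apply: cvg_pt3; [exact: cvg_id|exact: cvg_cst|exact: hr].
  by [].
have [] := nbhs_singleton (local_graph_smooth lg); rewrite coord_pt3 => _ dg ddg.
split.
- apply: filterS near_lg => s lgs Js; have [_ Ss] := Jh _ Js.
  by have := local_graph_eq lgs Ss; rewrite !coord_pt3 => ->; rewrite subrr.
- apply: (proj2 (derive_limit_zeros (is_derive_axis (dg e1)) Jr _)).
  apply: filterS near_lg => s lgs Js; have [s0 Ss] := Jh _ Js.
  by have [] := circle_partials rotS s0 Ss lgs.
- move=> r0.
  have dD := is_deriveB (is_deriveM (is_derive_id r (1 : R)) (is_derive_axis (ddg e1 e1)))
    (is_derive_axis (dg e0)).
  have [] := derive_limit_zeros dD Jr _.
    apply: filterS near_lg => s lgs Js; have [s0 Ss] := Jh _ Js.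
    have [_ E] := circle_partials rotS s0 Ss lgs.
    by rewrite -[LHS]/(s * 'D_e1 ('D_e1 g) (pt2 s 0) - 'D_e0 g (pt2 s 0)) E subrr.
  move=> _; rewrite r0 /GRing.scale /= mul0r add0r mulr1 => /eqP.
  by rewrite subr_eq0 => /eqP.
Qed.

End LocalProfile.

(** * Surfaces of constant ratio near a point *)

Section LocalProfileTheorem.
Context {R : realType}.
Implicit Types (f g : 'rV[R]_2 -> R) (S : set 'rV[R]_3) (r s z : R) (J : set R).

(** Along the profile [z = h(r)] the principal curvatures are [h''] and [h' / r],
    so [r h'' / h'] takes at most the values [a] and [a^-1]; being continuous, it
    is constant, and the resulting linear equation is solved by
    [profile_ode]. On the axis the curvatures coincide and [a = 1]. *)
Lemma local_profile (a : R) S r z :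
  a != 0 -> surface S -> rotation_invariant S -> constant_ratio a S ->
  0 <= r -> S (pt3 r 0 z) ->
  exists e C D, [/\ e = a \/ e = a^-1, C != 0, (r = 0 -> a = 1) &
    \forall q \near pt3 r 0 z,
      S q -> zcoord q = C * model_fun e (axis_dist2 q) + D].
Proof.
move=> a0 surfS rotS ratioS r0 Sp.
have [k1 [k2 [[f [lf char_f]] k_neq0 k_ratio]]] := ratioS _ Sp.
have near_lf := local_graph_near lf.
have [J [Jitv Jr [s1 Js1 s1r] JV nearJ]] := radii_interval surfS rotS r0 Sp lf near_lf.
pose h s := f (pt2 s 0); pose h1 s := 'D_e0 f (pt2 s 0).
pose h2 s := 'D_e0 ('D_e0 f) (pt2 s 0).
have J0 s : J s -> 0 <= s by move=> /JV[].
have Jh s : J s -> S (pt3 s 0 (h s)) /\ local_graph S (pt3 s 0 (h s)) f.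
  move=> /JV[_ [y Sy ly]]; have := local_graph_eq ly Sy.
  by rewrite !coord_pt3 /h => <-.
have zE : z = h r by have := local_graph_eq lf Sp; rewrite !coord_pt3.
have smooth s : J s -> \forall t \near s, thrice_differentiable f (pt2 t 0).
  by move=> /Jh[_ /local_graph_smooth_axis].
have dh s : J s -> is_derive s 1 h (h1 s).
  by move=> /smooth/nbhs_singleton[df _ _]; exact: is_derive_axis.
have dh1 s : J s -> is_derive s 1 h1 (h2 s).
  by move=> /smooth/nbhs_singleton[_ df _]; exact: is_derive_axis.
have dh2 s : J s -> is_derive s 1 h2 ('D_e0 ('D_e0 ('D_e0 f)) (pt2 s 0)).
  by move=> /smooth/nbhs_singleton[_ _ df]; exact: is_derive_axis.
(* Radii off the axis; they accumulate at every radius, the axis included. *)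
pose P := [set t | J t /\ 0 < t].
have Pitv : is_interval P.
  move=> x y [Jx x0] [Jy y0] t /andP[xt ty].
  by split; [apply: (Jitv x y) => //; apply/andP|exact: lt_le_trans xt].
have Plim s : J s -> limit_point P s.
  move=> Js; have [sr|sr] := eqVneq s r.
    by rewrite sr; exact: positive_limit_point Jitv Jr Js1 s1r J0.
  by apply: positive_limit_point Jitv Js Jr _ J0; rewrite eq_sym.
have Ph s : P s -> 0 < s /\ S (pt3 s 0 (h s)) by move=> [/Jh[]].
have hc s : J s -> {for s, continuous h} by move=> /dh; exact: is_derive_continuous.
have ode s : P s -> h1 s != 0 /\ (s * h2 s = a * h1 s \/ s * h2 s = a^-1 * h1 s).
  move=> Ps; have [Js s0] := Ps; have [_ Ss] := Ph _ Ps.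
  have [l1 [l2 [[g [lg char_g]] l_neq0 l_ratio]]] := ratioS _ Ss.
  have [hg g01 _] := profile_hessian rotS Ph (Plim _ Js) (hc _ Js) lg.
  have [_ g11] := circle_partials rotS s0 Ss lg.
  have smooth_g : \forall t \near s, thrice_differentiable g (pt2 t 0).
    exact: local_graph_smooth_axis lg.
  (* [ratioS] provides at [s] a local graph [g] that may differ from [f], but
     both agree on the profile, hence so do their radial derivatives. *)
  have dhg : \forall t \near s, is_derive (t : R) 1 (fun t => h t - g (pt2 t 0))
      (h1 t - 'D_e0 g (pt2 t 0)).
    apply: filterS (filterI (smooth _ Js) smooth_g) => t [[df _ _] [dg _ _]].
    exact: is_derive_axisB.
  have Plim' t : P t -> limit_point P t by move=> [/Plim].
  have h1g := derive_flat Plim' dhg hg.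
  have [_ dg _] := nbhs_singleton smooth_g.
  have [_ df _] := nbhs_singleton (smooth _ Js).
  have [h1gs h2gs] := derive_limit_zeros
    (is_derive_axisB (df e0) (dg e0)) (Plim _ Js) h1g.
  have -> : h1 s = 'D_e0 g (pt2 s 0) by apply/eqP; rewrite -subr_eq0 h1gs.
  have -> : h2 s = 'D_e0 ('D_e0 g) (pt2 s 0) by apply/eqP; rewrite -subr_eq0 h2gs.
  rewrite coord_pt3 in char_g.
  exact: ratio_off_axis a0 l_neq0 l_ratio char_g s0 g01 g11.
have [j [_ Pj _]] := limit_point_near (Plim _ Jr) (@filterT _ (nbhs r) _).
pose w s := s * h2 s / h1 s.
have w_ode s : P s -> s * h2 s = w s * h1 s.
  by move=> /ode[h1n0 _]; rewrite /w divfK.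
have w2 s : P s -> w s = a \/ w s = a^-1.
  by move=> /ode[h1n0 [E|E]]; [left|right]; rewrite /w E mulfK.
have wc s : P s -> {for s, continuous w}.
  move=> Ps; have [Js _] := Ps; have [h1n0 _] := ode _ Ps.
  apply: is_derive_continuous.
  exact: (is_deriveM (is_deriveM (is_derive_id s (1 : R)) (dh2 _ Js))
    (is_deriveV h1n0 (dh1 _ Js))).
have [C [D [C0 hE]]] : exists C D, C != 0 /\
    forall s, P s -> h s = C * model_fun (w j) (s ^+ 2) + D.
  apply: (@profile_ode R P (w j) h h1 h2 j Pitv Pj) => s Ps.
  - exact: Ps.2.
  - exact: dh _ Ps.1.
  - exact: dh1 _ Ps.1.
  - split; first by have [] := ode _ Ps.
    by rewrite w_ode // (two_valued_cst Pitv wc w2 Ps Pj).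
have axis : r = 0 -> a = 1.
  move=> r_eq0; have [_ f01 /(_ r_eq0) f11] := 
    profile_hessian rotS Ph (Plim _ Jr) (hc _ Jr) (proj2 (Jh _ Jr)).
  rewrite coord_pt3 r_eq0 in char_f f01.
  exact: ratio_on_axis a0 k_neq0 k_ratio char_f f01 f11.
exists (w j), C, D; split=> //; first exact: w2.
have near_pos : r != 0 -> \forall q \near pt3 r 0 z, 0 < radius q.
  move=> rn0; have radius_p : radius q @[q --> pt3 r 0 z] --> r.
    by rewrite -[X in _ --> X](radius_pt3 z r0); exact: radius_continuous.
  have r_gt0 : 0 < r by rewrite lt0r rn0.
  exact: (radius_p _ (lt_nbhsr r_gt0)).
have near_prof : \forall q \near pt3 r 0 z, local_graph S (profile q) f.
  have prof_p : profile q @[q --> pt3 r 0 z] --> pt3 r 0 z.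
    by rewrite -[X in _ --> X](profile_pt3 z r0); exact: profile_continuous.
  exact: (prof_p _ near_lf).
have hq q : S q -> local_graph S (profile q) f -> zcoord q = h (radius q).
  by move=> Sq lq; have := local_graph_eq lq (profile_in rotS Sq); rewrite !coord_pt3.
have [r_eq0|rn0] := eqVneq r 0; last first.
  have near_posr := near_pos rn0.
  near=> q => Sq; rewrite (hq q Sq); last by near: q.
  rewrite -sqr_radius hE //; split; last by near: q.
  by move: Sq; near: q.
have a1 := axis r_eq0.
have wj1 : w j = 1 by have [->|->] := w2 _ Pj; rewrite a1 ?invr1.
have hD : h 0 = D.
  have dmodel := is_deriveD (is_deriveZ C (is_derive_sqr r))
    (is_derive_cst D r (1 : R)).
  have [] := derive_limit_zeros (is_deriveB (dh _ Jr) dmodel) (Plim _ Jr) _.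
    near=> s => Ps; apply/eqP; rewrite subr_eq0; apply/eqP.
    by rewrite hE // wj1 model_fun1 ?sqr_ge0.
  move=> + _; rewrite r_eq0 => /eqP; rewrite subr_eq0 => /eqP ->.
  by rewrite -[LHS]/(C * 0 ^+ 2 + D) expr0n mulr0 add0r.
near=> q => Sq; rewrite (hq q Sq); last by near: q.
have Jq : J (radius q) by move: Sq; near: q.
have := J0 _ Jq; rewrite le_eqVlt => /orP[/eqP q0|q0]; last first.
  by rewrite -sqr_radius hE.
by rewrite -sqr_radius -q0 expr0n wj1 model_fun1// mulr0 add0r hD.
Unshelve. all: by end_near. Qed.

End LocalProfileTheorem.

(** * Surfaces of constant ratio globally *)

Section GlobalProfile.
Context {R : realType}.
Implicit Types (S : set 'rV[R]_3) (r s z e C D : R).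

Definition on_model e C D (q : 'rV[R]_3) :=
  zcoord q = C * model_fun e (axis_dist2 q) + D.

(** Two models agreeing on an interval of radii have equal first and second
    derivatives there, and [r y' = e y] for the first derivative [y] recovers
    the exponent. *)
Lemma profile_params_unique (a : R) S r z e C D e' C' D' :
  surface S -> rotation_invariant S -> constant_ratio a S ->
  0 <= r -> S (pt3 r 0 z) -> C != 0 ->
  (\forall q \near pt3 r 0 z, S q -> on_model e C D q) ->
  (\forall q \near pt3 r 0 z, S q -> on_model e' C' D' q) ->
  [/\ e = e', C = C' & D = D'].
Proof.
move=> surfS rotS ratioS r0 Sp C0 near1 near2.
have [_ [_ [[f [lf _]] _ _]]] := ratioS _ Sp.
have [J [Jitv Jr [s1 Js1 s1r] JV _]] :=
  radii_interval surfS rotS r0 Sp lf (filterI near1 near2).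
have J0 s : J s -> 0 <= s by move=> /JV[].
pose P := [set t | J t /\ 0 < t].
have Plim s : P s -> limit_point P s.
  move=> [Js s0]; have [sr|sr] := eqVneq s r.
    by rewrite sr; exact: positive_limit_point Jitv Jr Js1 s1r J0.
  by apply: positive_limit_point Jitv Js Jr _ J0; rewrite eq_sym.
have [j [_ Pj _]] := limit_point_near
  (positive_limit_point Jitv Jr Js1 s1r J0) (@filterT _ (nbhs r) _).
have j0 : 0 < j by case: Pj.
have agree s : P s ->
    C * model_fun e (s ^+ 2) + D = C' * model_fun e' (s ^+ 2) + D'.
  move=> [/JV[_ [y Sy [/(_ Sy) on1 /(_ Sy) on2]]] _]; move: on1 on2.
  by rewrite /on_model !axis_dist2_pt3 !coord_pt3 expr0n addr0 => <- <-.
pose phi s := C * model_fun e (s ^+ 2) - C' * model_fun e' (s ^+ 2) - (D' - D).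
pose phi1 s := C * (2 * s * model_slope e (s ^+ 2)) -
  C' * (2 * s * model_slope e' (s ^+ 2)).
have dphi s : 0 < s -> is_derive s 1 phi (phi1 s).
  move=> s0; apply: is_derive_eq (is_deriveB (is_deriveB
    (is_deriveZ C (is_derive_model_sqr e s0))
    (is_deriveZ C' (is_derive_model_sqr e' s0))) (is_derive_cst (D' - D) s (1 : R))) _.
  by rewrite subr0.
have phi0 : \forall s \near j, P s -> phi s = 0.
  apply: (@filterS _ (nbhs j) _ setT _ _ filterT) => s _ /agree; rewrite /phi.
  by move: (model_fun _ _) (model_fun _ _) => x y E; lra.
have near_dphi : \forall s \near j, is_derive (s : R) 1 phi (phi1 s).
  by apply: filterS (lt_nbhsr j0) => s; exact: dphi.
have phi10 := derive_flat Plim near_dphi phi0.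
have [phi1j phi2j] := derive_limit_zeros (is_deriveB
    (is_deriveZ C (is_derive_model_slope_sqr e j0))
    (is_deriveZ C' (is_derive_model_slope_sqr e' j0))) (Plim _ Pj) phi10.
have M0 := model_slope_neq0 e (exprn_gt0 2 j0).
have slopes : C * model_slope e (j ^+ 2) = C' * model_slope e' (j ^+ 2).
  apply: (@mulfI _ (2 * j)); first by rewrite mulf_neq0 ?pnatr_eq0// gt_eqF.
  move: phi1j; rewrite -[LHS]/(phi1 j) /phi1.
  by move: (model_slope _ _) (model_slope _ _) => x y E; lra.
have ee : e = e'.
  apply: (@mulIf _ (C * model_slope e (j ^+ 2))); first exact: mulf_neq0.
  rewrite [in RHS]slopes; move: phi2j; rewrite /GRing.scale /=.
  by move: (model_slope _ _) (model_slope _ _) => x y E; lra.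
have CC : C = C' by apply: (mulIf M0); rewrite slopes ee.
by split=> //; have := agree _ Pj; rewrite -ee -CC => /addrI.
Qed.

(** The points near which [S] lies on the model with fixed parameters form a set
    that is open, and also closed in [S], since near every other point [S] lies
    on a model with other parameters. *)
Lemma global_profile (a : R) S :
  a != 0 -> surface S -> rotation_invariant S -> constant_ratio a S ->
  exists e C D, [/\ e = a \/ e = a^-1, C != 0,
    forall q, S q -> on_model e C D q &
    forall q, S q -> axis_dist2 q = 0 -> a = 1].
Proof.
move=> a0 surfS rotS ratioS.
have local q : S q -> exists e C D, [/\ e = a \/ e = a^-1, C != 0,
    (axis_dist2 q = 0 -> a = 1) & \forall q' \near profile q, S q' -> on_model e C D q'].
  move=> Sq; have [e [C [D [ea C0 axis near_q]]]] :=
    local_profile a0 surfS rotS ratioS (radius_ge0 q) (profile_in rotS Sq).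
  by exists e, C, D; split=> // q0; apply: axis; rewrite /radius q0 sqrtr0.
have [[p Sp]|noS] := pselect (S !=set0); last first.
  exists a, 1, 0; split=> [|| q Sq|q Sq]; [by left|exact: oner_neq0| |];
    by exfalso; apply: noS; exists q.
have [e [C [D [ea C0 _ near_p]]]] := local _ Sp.
exists e, C, D; split=> //; last by move=> q /local[? [? [? []]]].
pose model_at e C D := profile @^-1` [set q | S q -> on_model e C D q]°.
have model_open e1 C1 D1 : open (model_at e1 C1 D1).
  by apply: open_comp; [move=> q _; exact: profile_continuous|exact: open_interior].
suff B_all : S `&` model_at e C D = S.
  move=> q Sq; have [_ Bq] : (S `&` model_at e C D) q by rewrite B_all.
  have := nbhs_singleton Bq (profile_in rotS Sq).
  by rewrite /on_model axis_dist2_pt3 coord_pt3 expr0n addr0 sqr_radius.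
have [connS _] := surfS; apply: connS.
- by exists p; split.
- by exists (model_at e C D).
pose others := \bigcup_(t in [set t : R * R * R | t != (e, C, D)])
  [set q | t.1.2 != 0 /\ model_at t.1.1 t.1.2 t.2 q].
exists (~` others).
  apply: open_closedC; apply: bigcup_open => -[[e1 C1] D1] _ /=.
  have [->|C10] := eqVneq C1 0.
    by rewrite (_ : [set _ | _] = set0) ?eqxx; [exact: open0|apply/seteqP; split => q []].
  rewrite (_ : [set _ | _] = model_at e1 C1 D1); first exact: model_open.
  by apply/seteqP; split=> [q []|q].
apply/seteqP; split=> q [Sq Bq]; split; [exact: Sq| |exact: Sq|].
  move=> [[[e1 C1] D1] /= /eqP t_neq [C10 near_q]]; apply: t_neq.
  by have [-> -> ->] := profile_params_unique surfS rotS ratioS (radius_ge0 q)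
    (profile_in rotS Sq) C10 near_q Bq.
have [e1 [C1 [D1 [_ C10 _ near_q]]]] := local _ Sq.
have [[<- <- <-] //|/eqP t_neq] := pselect ((e1, C1, D1) = (e, C, D)).
by exfalso; apply: Bq; exists (e1, C1, D1).
Qed.

End GlobalProfile.

(** * Maps of class C^k *)

Section ClassC.
Context {R : realType}.
Implicit Types (V W : normedModType R) (k : nat).

(** Differentiability is local: a function that vanishes near a point is its own
    remainder term there. *)
Lemma near0_differentiable V W (h : V -> W) x :
  (\forall y \near x, h y = 0) -> differentiable h x.
Proof.
move=> h0; have hx := nbhs_singleton h0.
have near_h : \forall y \near (0 : V), h (y + x) = 0.
  by have := h0; rewrite (near_shift 0 x) subr0; apply: filterS.
have E : h \o shift x = cst (h x) + (\0 : V -> W) +o_ 0 id.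
  apply/eqaddoP => _/posnumP[e]; apply: filterS near_h => y hy.
  by rewrite !fctE /= hy hx !(addr0, oppr0) normr0 mulr_ge0.
have /= d0 : 'd h x = (\0 : V -> W) :> (V -> W).
  by apply: diff_unique E; exact: cst_continuous.
by apply/diff_locallyP; rewrite d0; split; [exact: cst_continuous|].
Qed.

Lemma near_eq_differentiable V W (f g : V -> W) x :
  (\forall y \near x, f y = g y) -> differentiable f x -> differentiable g x.
Proof.
move=> fg df; have -> : g = f + (g - f).
  by apply/funext => y; rewrite !fctE addrC subrK.
apply: (differentiableD df); apply: near0_differentiable.
by apply: filterS fg => y; rewrite !fctE => ->; rewrite subrr.
Qed.

Lemma class_C_eq V W k (U : set V) (f g : V -> W) :
  open U -> (forall x, U x -> f x = g x) -> class_C k U f -> class_C k U g.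
Proof.
move=> Uo; elim: k f g => [|k IH] f g fg.
  move=> fc x Ux; have near_fg : \forall y \near x, f y = g y.
    by apply: filterS (open_nbhs_nbhs (conj Uo Ux)); exact: fg.
  have := fc _ Ux; rewrite /prop_for /continuous_at (fg _ Ux).
  exact: cvg_trans (near_eq_cvg near_fg).
have near_fg x : U x -> \forall y \near x, f y = g y.
  by move=> Ux; apply: filterS (open_nbhs_nbhs (conj Uo Ux)); exact: fg.
move=> [df Df]; split=> [x Ux|v].
  exact: near_eq_differentiable (near_fg _ Ux) (df _ Ux).
by apply: IH (Df v) => x Ux; apply: near_eq_derive; exact: near_fg.
Qed.

Lemma class_C_cst V W k (U : set V) (c : W) : class_C k U (fun=> c).
Proof.
elim: k c => [|k IH] c; first by move=> x _; exact: cst_continuous.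
split=> [x _|v]; first exact: differentiable_cst.
have -> : (fun x => 'D_v (fun=> c : W) x) = (fun=> 0) :> (V -> W).
  by apply/funext => x; rewrite derive_cst.
exact: IH.
Qed.

Lemma class_CW V W k (U : set V) (f : V -> W) : class_C k.+1 U f -> class_C k U f.
Proof.
elim: k f => [|k IH] f [df Df].
  by move=> x Ux; apply: differentiable_continuous; exact: df.
by split=> // v; apply: IH; exact: Df.
Qed.

Lemma class_CD V W k (U : set V) (f g : V -> W) : open U ->
  class_C k U f -> class_C k U g -> class_C k U (fun x => f x + g x).
Proof.
move=> Uo; elim: k f g => [|k IH] f g.
  by move=> fc gc x Ux; exact: cvgD (fc _ Ux) (gc _ Ux).
move=> [df Df] [dg Dg]; split=> [x Ux|v].
  exact: differentiableD (df _ Ux) (dg _ Ux).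
apply: (class_C_eq Uo _ (IH _ _ (Df v) (Dg v))) => x Ux.
exact/esym/(deriveD (diff_derivable (df _ Ux)) (diff_derivable (dg _ Ux))).
Qed.

Lemma class_CZ V W k (U : set V) (f : V -> W) (c : R) : open U ->
  class_C k U f -> class_C k U (fun x => c *: f x).
Proof.
move=> Uo; elim: k f => [|k IH] f.
  by move=> fc x Ux; exact: (cvgZl_tmp (fc _ Ux)).
move=> [df Df]; split=> [x Ux|v]; first exact: differentiableZ (df _ Ux).
apply: (class_C_eq Uo _ (IH _ (Df v))) => x Ux.
exact/esym/(deriveZ c (diff_derivable (df _ Ux))).
Qed.

Lemma class_CM V k (U : set V) (f g : V -> R) : open U ->
  class_C k U f -> class_C k U g -> class_C k U (fun x => f x * g x).
Proof.
move=> Uo; elim: k f g => [|k IH] f g.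
  by move=> fc gc x Ux; exact: cvgM (fc _ Ux) (gc _ Ux).
move=> fC gC; have [df Df] := fC; have [dg Dg] := gC; split=> [x Ux|v].
  exact: differentiableM (df _ Ux) (dg _ Ux).
have := class_CD Uo (IH _ _ (class_CW fC) (Dg v)) (IH _ _ (class_CW gC) (Df v)).
apply: class_C_eq => // x Ux.
exact/esym/(deriveM (diff_derivable (df _ Ux)) (diff_derivable (dg _ Ux))).
Qed.

Lemma class_C_comp_affine V V' W k (U : set V) (f : V -> W) (L : V' -> V)
    (A : V' -> V) :
  open U -> (forall x, differentiable L x) -> (forall v x, 'D_v L x = A v) ->
  class_C k U f -> class_C k (L @^-1` U) (f \o L).
Proof.
move=> Uo dL DL.
have Lo : open (L @^-1` U).
  by apply: open_comp => // x _; exact: differentiable_continuous.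
elim: k f => [|k IH] f.
  move=> fc x Ux; apply: continuous_comp; last exact: fc.
  exact: differentiable_continuous.
move=> [df Df]; split=> [x Ux|v].
  exact: differentiable_comp (dL x) (df _ Ux).
apply: (class_C_eq Lo _ (IH _ (Df (A v)))) => x Ux.
have dLv : 'd L x v = A v by rewrite -(deriveE _ (dL x)) DL.
rewrite [RHS](deriveE _ (differentiable_comp (dL x) (df _ Ux))).
by rewrite (diff_comp (dL x) (df _ Ux)) /= dLv (deriveE _ (df _ Ux)).
Qed.

Lemma derive_coord j (v x : 'rV[R]_2) : 'D_v (fun u : 'rV[R]_2 => u 0 j : R) x = v 0 j.
Proof.
have := derive_mx (@derivable_id _ _ x v); rewrite derive_id => Dv.
by rewrite [in RHS]Dv mxE.
Qed.

Lemma class_C_coord k (U : set 'rV[R]_2) j : class_C k U (fun u => u 0 j).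
Proof.
case: k => [|k]; first by move=> x _; exact: (@coord_continuous R 1 2).
split=> [x _|v]; first exact: differentiable_coord.
have -> : (fun x => 'D_v (fun u : 'rV[R]_2 => u 0 j : R) x) = (fun=> v 0 j).
  by apply/funext => x; rewrite derive_coord.
exact: class_C_cst.
Qed.

End ClassC.

(** * The group of general isotropic similarities *)

Section Similarities.
Context {R : realType}.
Implicit Types (T : 'rV[R]_3 -> 'rV[R]_3) (S M : set 'rV[R]_3).

Lemma isotropic_mx_unit (s : bool) (h1 h2 c1 c2 c3 : R) :
  (isotropic_mx s h1 h2 c1 c2 c3 \in unitmx) =
  (h1 ^+ 2 + h2 ^+ 2 != 0) && (c3 != 0).
Proof.
rewrite unitmxE unitfE.
have -> : \det (isotropic_mx s h1 h2 c1 c2 c3) = (-1) ^+ s * ((h1 ^+ 2 + h2 ^+ 2) * c3).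
  rewrite (expand_det_row _ 0) !big_ord_recl big_ord0 /cofactor !det_mx22 !mxE /=.
  by rewrite /bump /= !(expr0, expr1, expr2); ring.
by rewrite mulf_eq0 signr_eq0 /= mulf_eq0 negb_or.
Qed.

Lemma isotropic_affine_comp (s s' : bool) (h k c d e h' k' c' d' e' : R) b b' p :
  affine_map (isotropic_mx s' h' k' c' d' e') b'
    (affine_map (isotropic_mx s h k c d e) b p) =
  affine_map
    (isotropic_mx (s (+) s') (h' * h - (-1) ^+ s * k' * k)
       ((-1) ^+ s * k' * h + h' * k)
       (c' * (-1) ^+ s * h + d' * k + e' * c) (- c' * (-1) ^+ s * k + d' * h + e' * d)
       (e' * e))
    (affine_map (isotropic_mx s' h' k' c' d' e') b' b) p.
Proof.
rewrite !isotropic_affineE !coord_pt3 signr_addb.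
by congr pt3; case: s; rewrite /= ?expr0 ?expr1; ring.
Qed.

Lemma similarity_comp T T' :
  general_isotropic_similarity T -> general_isotropic_similarity T' ->
  general_isotropic_similarity (T' \o T).
Proof.
move=> [s [h [k [c [d [e [b [+ ->]]]]]]]] [s' [h' [k' [c' [d' [e' [b' [+ ->]]]]]]]].
rewrite !isotropic_mx_unit => /andP[n0 e0] /andP[n0' e0'].
do 7 eexists; split; last first.
  by apply/funext => p; exact: isotropic_affine_comp.
rewrite isotropic_mx_unit mulf_neq0 // andbT.
have -> : (h' * h - (-1) ^+ s * k' * k) ^+ 2 + ((-1) ^+ s * k' * h + h' * k) ^+ 2 =
    (h ^+ 2 + k ^+ 2) * (h' ^+ 2 + k' ^+ 2).
  by case: s {n0 n0'}; rewrite ?expr0 ?expr1; ring.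
exact: mulf_neq0.
Qed.

(** The linear part on the top view is [n^(1/2)] times an orthogonal matrix, with
    [n = h^2 + k^2], so its inverse is its transpose divided by [n]. *)
Lemma similarity_inverse T : general_isotropic_similarity T ->
  exists T', general_isotropic_similarity T' /\ cancel T T'.
Proof.
move=> [s [h [k [c [d [e [b [+ ->]]]]]]]]; rewrite isotropic_mx_unit => /andP[n0 e0].
pose n := h ^+ 2 + k ^+ 2.
pose A' := isotropic_mx s (h / n) (- ((-1) ^+ s * k / n))
  (- (c * h - d * k) * (-1) ^+ s / n / e) (- (c * k + d * h) / n / e) e^-1.
exists (affine_map A' (- (b *m A'^T))); split.
  exists s; do 6 eexists; split; last by [].
  rewrite isotropic_mx_unit invr_neq0 // andbT.
  have -> : (h / n) ^+ 2 + (- ((-1) ^+ s * k / n)) ^+ 2 = n^-1.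
    by rewrite sqrrN !exprMn sqrr_sign mul1r -mulrDl exprVn -/n expr2 invfM mulVKf.
  exact: invr_neq0.
move=> p; have -> : affine_map A' (- (b *m A'^T)) (affine_map (isotropic_mx s h k c d e) b p) =
    affine_map A' 0 (affine_map (isotropic_mx s h k c d e) 0 p).
  by rewrite /affine_map !addr0 mulmxDl addrK.
rewrite !isotropic_affineE !coord_pt3 [RHS]pt3E.
have -> : (xcoord 0 = 0 :> R) by rewrite /xcoord mxE.
have -> : (ycoord 0 = 0 :> R) by rewrite /ycoord mxE.
have -> : (zcoord 0 = 0 :> R) by rewrite /zcoord mxE.
rewrite /n; congr pt3; case: s {A'}; rewrite ?expr0 ?expr1; field; by rewrite ?e0 ?n0.
Qed.

Lemma congruence_similarity T :
  isotropic_congruence T -> general_isotropic_similarity T.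
Proof.
move=> [s [t [c1 [c2 [b ->]]]]]; exists s, (cos t), (sin t), c1, c2, 1, b; split => //.
by rewrite isotropic_mx_unit cos2Dsin2 !oner_neq0.
Qed.

End Similarities.

(** * Principal curvatures under similarities *)

Section Pullback.
Context {R : realType}.
Implicit Types (T : 'rV[R]_3 -> 'rV[R]_3) (S M : set 'rV[R]_3) (F : 'rV[R]_2 -> R).

Lemma derive_partials F u v :
  differentiable F u -> 'D_v F u = v 0 0 * 'D_e0 F u + v 0 1 * 'D_e1 F u.
Proof. by move=> dF; rewrite deriveE // diff_partials. Qed.

Lemma derive2_partials F u v w : (\forall x \near u, thrice_differentiable F x) ->
  'D_w ('D_v F) u =
  v 0 0 * (w 0 0 * 'D_e0 ('D_e0 F) u + w 0 1 * 'D_e1 ('D_e0 F) u) +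
  v 0 1 * (w 0 0 * 'D_e0 ('D_e1 F) u + w 0 1 * 'D_e1 ('D_e1 F) u).
Proof.
move=> smooth; have [_ dF _] := nbhs_singleton smooth.
have near_v : \forall x \near u, 'D_v F x = (v 0 0 *: 'D_e0 F + v 0 1 *: 'D_e1 F) x.
  by apply: filterS smooth => x [dFx _ _]; rewrite derive_partials.
rewrite (near_eq_derive _ near_v).
have DD := is_deriveD
  (is_deriveZ (v 0 0) (derivableP (diff_derivable (v := w) (dF e0))))
  (is_deriveZ (v 0 1) (derivableP (diff_derivable (v := w) (dF e1)))).
rewrite (@derive_val _ _ _ _ _ _ _ DD).
by congr (_ * _ + _ * _); exact: derive_partials.
Qed.

Section AffineForm.
Variables (a b c : R).

Let l (u : 'rV[R]_2) : R := a * u 0 0 + b * u 0 1 + c.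

Lemma is_derive_affine_form u v : is_derive u v l (a * v 0 0 + b * v 0 1).
Proof.
have dcoord j : is_derive u v (fun x : 'rV[R]_2 => x 0 j : R) (v 0 j).
  by apply: DeriveDef; [exact/diff_derivable/differentiable_coord|exact: derive_coord].
apply: is_derive_eq (is_deriveD (is_deriveD (is_deriveZ a (dcoord 0))
  (is_deriveZ b (dcoord 1))) (is_derive_cst c u v)) _.
by rewrite addr0.
Qed.

Lemma differentiable_affine_form u : differentiable l u.
Proof.
apply: differentiableD; last exact: differentiable_cst.
by apply: differentiableD; apply: differentiableM;
  [exact: differentiable_cst|exact: differentiable_coord
  |exact: differentiable_cst|exact: differentiable_coord].
Qed.

Lemma class_C_affine_form n : class_C n setT l.
Proof.
have coordC x j : class_C n setT (fun u : 'rV[R]_2 => x *: (u 0 j : R^o)).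
  by apply: class_CZ; [exact: openT|exact: class_C_coord].
apply: class_CD; [exact: openT| |exact: class_C_cst].
by apply: class_CD; [exact: openT|exact: coordC|exact: coordC].
Qed.

End AffineForm.

Lemma differentiable_affine_map (a b c a' b' c' : R) (u : 'rV[R]_2) :
  differentiable (fun u : 'rV[R]_2 =>
    pt2 (a * u 0 0 + b * u 0 1 + c) (a' * u 0 0 + b' * u 0 1 + c')) u.
Proof.
under eq_fun do rewrite pt2_basis.
by apply: differentiableD; apply: differentiableZl; exact: differentiable_affine_form.
Qed.

Lemma derive_affine_map (a b c a' b' c' : R) (v u : 'rV[R]_2) :
  'D_v (fun u : 'rV[R]_2 =>
    pt2 (a * u 0 0 + b * u 0 1 + c) (a' * u 0 0 + b' * u 0 1 + c')) u =
  pt2 (a * v 0 0 + b * v 0 1) (a' * v 0 0 + b' * v 0 1).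
Proof.
rewrite derive_mx; last exact/diff_derivable/differentiable_affine_map.
rewrite [LHS]pt2E !mxE; congr pt2.
  under [X in 'D_v X _]eq_fun do rewrite mxE /=.
  exact: (@derive_val _ _ _ _ _ _ _ (is_derive_affine_form a b c u v)).
under [X in 'D_v X _]eq_fun do rewrite mxE /=.
exact: (@derive_val _ _ _ _ _ _ _ (is_derive_affine_form a' b' c' u v)).
Qed.

End Pullback.

Section PullbackTheorem.
Context {R : realType}.
Implicit Types (T : 'rV[R]_3 -> 'rV[R]_3) (S M : set 'rV[R]_3) (F : 'rV[R]_2 -> R).

Lemma is_derive_comp_affine (G : 'rV[R]_2 -> R) (L A : 'rV[R]_2 -> 'rV[R]_2) x v :
  differentiable L x -> 'D_v L x = A v -> differentiable G (L x) ->
  is_derive x v (fun u => G (L u)) ('D_(A v) G (L x)).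
Proof.
move=> dL DL dG; have dGL := differentiable_comp dL dG.
apply: DeriveDef; first exact: (diff_derivable dGL).
rewrite -[LHS]/('D_v (G \o L) x) (deriveE _ dGL) (diff_comp dL dG) /=.
by rewrite -(deriveE _ dL) DL (deriveE _ dG).
Qed.

Lemma isotropic_affine_continuous (s : bool) (h k c d e : R) b :
  continuous (affine_map (isotropic_mx s h k c d e) b).
Proof.
have form_cont (x y z t : R) :
    continuous (fun q : 'rV[R]_3 => x * q 0 0 + y * q 0 1 + z * q 0 2 + t : R).
  move=> q; have coord j : {for q, continuous (fun q : 'rV[R]_3 => q 0 j : R)}.
    exact: (@coord_continuous R 1 3).
  exact: (cvgD (cvgD (cvgD (cvgM (cvg_cst x) (coord 0)) (cvgM (cvg_cst y) (coord 1)))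
    (cvgM (cvg_cst z) (coord 2))) (cvg_cst t)).
pose sg : R := (-1) ^+ s.
have -> : affine_map (isotropic_mx s h k c d e) b = fun q => pt3
    (sg * h * q 0 0 + - sg * k * q 0 1 + 0 * q 0 2 + xcoord b)
    (k * q 0 0 + h * q 0 1 + 0 * q 0 2 + ycoord b)
    (c * q 0 0 + d * q 0 1 + e * q 0 2 + zcoord b).
  apply/funext => q; rewrite isotropic_affineE -/sg /xcoord /ycoord /zcoord.
  by congr pt3; ring.
move=> q; exact: (cvg_pt3 (@form_cont _ _ _ _ q) (@form_cont _ _ _ _ q)
  (@form_cont _ _ _ _ q)).
Qed.

Lemma class_C_sub (V W : normedModType R) k (U U' : set V) (f : V -> W) :
  U `<=` U' -> class_C k U' f -> class_C k U f.
Proof.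
move=> UU'; elim: k f => [|k IH] f; first by move=> fc x /UU'; exact: fc.
by move=> [df Df]; split=> [x /UU'/df//|v]; exact: IH (Df v).
Qed.

(** A similarity acts on the height function by an affine substitution with
    conformal linear part [A], a factor [e^-1] and an additive affine form; the
    latter has no second derivatives and conjugation by [A] multiplies the trace
    and the determinant of the Hessian by [h^2 + k^2] and its square. *)
Lemma principal_curvatures_pullback T S M p (k1 k2 : R) :
  general_isotropic_similarity T -> (forall q, S q -> M (T q)) ->
  principal_curvatures M (T p) k1 k2 ->
  exists2 l, l != 0 & principal_curvatures S p (l * k1) (l * k2).
Proof.
move=> [s [h [k [c [d [e [b [+ ->]]]]]]]] SM; rewrite isotropic_mx_unit => /andP[n0 en0].
move=> [F [lF char_F]]; pose sg : R := (-1) ^+ s.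
have sg2 : sg ^+ 2 = 1 by exact: sqrr_sign.
pose L (u : 'rV[R]_2) := pt2 (sg * h * u 0 0 + - sg * k * u 0 1 + xcoord b)
  (k * u 0 0 + h * u 0 1 + ycoord b).
pose A (v : 'rV[R]_2) := pt2 (sg * h * v 0 0 + - sg * k * v 0 1) (k * v 0 0 + h * v 0 1).
have dL u : differentiable L u by exact: differentiable_affine_map.
have DL v u : 'D_v L u = A v by exact: derive_affine_map.
pose sim := affine_map (isotropic_mx s h k c d e) b.
have topT q : top_view (sim q) = L (top_view q).
  rewrite /sim isotropic_affineE top_view_pt3 /L !mxE /= -/sg.
  by congr pt2; ring.
pose l (u : 'rV[R]_2) := - (c / e) * u 0 0 + - (d / e) * u 0 1 + - (zcoord b / e).
pose f u := e^-1 *: (F (L u) : R^o) + l u.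
have [[U [Uo Up FC]] graph] := lF.
have simcont : continuous sim by exact: isotropic_affine_continuous.
have lf : local_graph S p f.
  split.
    exists (L @^-1` U); split.
    - apply: open_comp => // x _; exact: differentiable_continuous.
    - by rewrite /preimage /= -topT.
    - have Lo : open (L @^-1` U).
        by apply: open_comp => // x _; exact: differentiable_continuous.
      apply: class_CD => //.
        by apply: class_CZ => //; exact: class_C_comp_affine FC.
      exact: class_C_sub (class_C_affine_form _ _ _ 3).
  have := simcont p _ graph => /= near_graph.
  apply: (@filterS _ (nbhs p) _ _ _ _ near_graph) => q /= + Sq.
  rewrite -/sim topT => /(_ (SM _ Sq)).
  rewrite /sim isotropic_affineE zcoord_pt3 /f => <-.
  by rewrite /l !mxE /GRing.scale /=; field.
exists ((h ^+ 2 + k ^+ 2) / e); first by rewrite mulf_neq0 ?invr_neq0.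
exists f; split=> //.
have near_smooth : \forall u \near top_view p, thrice_differentiable F (L u).
  have := local_graph_smooth lF; rewrite topT => smooth.
  exact: (differentiable_continuous (dL (top_view p)) smooth).
have Df v u : thrice_differentiable F (L u) ->
    'D_v f u = e^-1 * 'D_(A v) F (L u) + (- (c / e) * v 0 0 + - (d / e) * v 0 1).
  move=> [dF _ _].
  have DD := is_deriveD (is_deriveZ e^-1 (is_derive_comp_affine (dL u) (DL v u) dF))
    (is_derive_affine_form (- (c / e)) (- (d / e)) (- (zcoord b / e)) u v).
  by rewrite (@derive_val _ _ _ _ _ _ _ DD).
have DDf v w : 'D_w ('D_v f) (top_view p) = e^-1 * 'D_(A w) ('D_(A v) F) (L (top_view p)).
  have near_D : \forall u \near top_view p, 'D_v f u =
      e^-1 *: ('D_(A v) F (L u) : R^o) + (- (c / e) * v 0 0 + - (d / e) * v 0 1).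
    by apply: filterS near_smooth => u; exact: Df.
  rewrite (near_eq_derive _ near_D).
  have [_ dF _] := nbhs_singleton near_smooth.
  have DD := is_deriveD (is_deriveZ e^-1
      (is_derive_comp_affine (dL _) (DL w (top_view p)) (dF (A v))))
    (is_derive_cst (- (c / e) * v 0 0 + - (d / e) * v 0 1) (top_view p) w).
  by rewrite (@derive_val _ _ _ _ _ _ _ DD) addr0.
have smoothT := local_graph_smooth lF; rewrite topT in smoothT.
move: char_F; rewrite topT.
pose f00 := 'D_e0 ('D_e0 F) (L (top_view p)).
pose f10 := 'D_e1 ('D_e0 F) (L (top_view p)).
pose f01 := 'D_e0 ('D_e1 F) (L (top_view p)).
pose f11 := 'D_e1 ('D_e1 F) (L (top_view p)).
have hess v w : 'D_w ('D_v f) (top_view p) =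
    e^-1 * (A v 0 0 * (A w 0 0 * f00 + A w 0 1 * f10) +
            A v 0 1 * (A w 0 0 * f01 + A w 0 1 * f11)).
  by rewrite DDf (derive2_partials _ _ smoothT).
move=> /(@char_poly_hessian _ F _ f00 f11 f01 f10 _ _ erefl erefl erefl erefl)[sum prod].
apply/(char_poly_hessian _ _ (hess e0 e0) (hess e1 e1) (hess e1 e0) (hess e0 e1)).
move: f00 f10 f01 f11 sum prod {hess DDf} => f00 f10 f01 f11 sum prod.
rewrite -mulrDr sum mulrACA prod /A !coord_basis !mxE /=.
have {sg2} : sg = 1 \/ sg = -1.
  by move/eqP: sg2; rewrite sqrf_eq1 => /orP[] /eqP; [left|right].
move: (sg) => x x1.
by split; case: x1 => ->; field.
Qed.

End PullbackTheorem.

(** * Curvatures of the model surfaces *)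

Section Models.
Context {R : realType}.
Implicit Types (e b : R) (p q : 'rV[R]_3) (u v w : 'rV[R]_2) (M : set 'rV[R]_3).

Definition norm2 u : R := u 0 0 ^+ 2 + u 0 1 ^+ 2.
Definition dot u v : R := u 0 0 * v 0 0 + u 0 1 * v 0 1.

Lemma norm2_top_view p : norm2 (top_view p) = axis_dist2 p.
Proof. by rewrite /norm2 !mxE. Qed.

Lemma class_C_norm2 k : class_C k setT norm2.
Proof.
have coordC j : class_C k setT (fun u : 'rV[R]_2 => u 0 j : R) by exact: class_C_coord.
have sqrC j : class_C k setT (fun u : 'rV[R]_2 => u 0 j * u 0 j).
  by apply: class_CM; [exact: openT|exact: coordC|exact: coordC].
have := class_CD (@openT _) (sqrC 0) (sqrC 1).
by apply: class_C_eq; [exact: openT|move=> u _; rewrite /norm2 !expr2].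
Qed.

Lemma class_C_dot k v : class_C k setT (dot ^~ v).
Proof.
have := class_C_affine_form (v 0 0) (v 0 1) 0 k.
by apply: class_C_eq; [exact: openT|move=> u _; rewrite /dot addr0 mulrC (mulrC (v 0 1))].
Qed.

Lemma differentiable_norm2 u : differentiable norm2 u.
Proof. by have [+ _] := class_C_norm2 1; apply. Qed.

Lemma is_derive_dot u v w : is_derive u w (dot ^~ v) (dot w v).
Proof.
have := is_derive_affine_form (v 0 0) (v 0 1) 0 u w.
have -> : (fun u : 'rV[R]_2 => v 0 0 * u 0 0 + v 0 1 * u 0 1 + 0) = (dot ^~ v).
  by apply/funext => x; rewrite /dot addr0 mulrC (mulrC (v 0 1)).
by move/is_derive_eq; apply; rewrite /dot; ring.
Qed.

Lemma is_derive_norm2 u v : is_derive u v norm2 (2 * dot u v).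
Proof.
have dcoord j : is_derive u v (fun x : 'rV[R]_2 => x 0 j : R) (v 0 j).
  by apply: DeriveDef; [exact/diff_derivable/differentiable_coord|exact: derive_coord].
have DD := is_deriveD (is_deriveM (dcoord 0) (dcoord 0)) (is_deriveM (dcoord 1) (dcoord 1)).
have -> : norm2 = (fun x : 'rV[R]_2 => x 0 0 * x 0 0 + x 0 1 * x 0 1).
  by apply/funext => x; rewrite /norm2 !expr2.
by apply: is_derive_eq DD _; rewrite /GRing.scale /dot /=; ring.
Qed.

Lemma differentiable_radial (phi : R -> R) (d : R) u :
  is_derive (norm2 u) 1 phi d -> differentiable (fun x => phi (norm2 x)) u.
Proof.
move=> [/derivable1_diffP dphi _].
exact: (differentiable_comp (differentiable_norm2 u) dphi).
Qed.

Lemma is_derive_radial (phi : R -> R) (d : R) u v :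
  is_derive (norm2 u) 1 phi d ->
  is_derive u v (fun x => phi (norm2 x)) (d * (2 * dot u v)).
Proof.
move=> dphi; have dphi_u := differentiable_radial dphi.
have [/derivable1_diffP dphi' <-] := dphi.
apply: DeriveDef; first exact: diff_derivable dphi_u.
rewrite (deriveE _ dphi_u) (diff_comp (differentiable_norm2 u) dphi') /=.
rewrite -(deriveE _ (differentiable_norm2 u)).
rewrite (@derive_val _ _ _ _ _ _ _ (is_derive_norm2 u v)).
by rewrite (diff1E dphi') derive1E; exact: mulrC.
Qed.

Lemma open_norm2_pos : open [set u | 0 < norm2 u].
Proof.
apply: (@open_comp _ _ norm2 [set x : R | 0 < x]); last exact: open_gt.
by move=> u _; exact/differentiable_continuous/differentiable_norm2.
Qed.

Lemma class_C_radial_powR k b :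
  class_C k [set u | 0 < norm2 u] (fun u => norm2 u `^ b).
Proof.
elim: k b => [|k IH] b.
  move=> u u0; apply: differentiable_continuous.
  exact: differentiable_radial (is_derive1_powR b u0).
split=> [u u0|v]; first exact: differentiable_radial (is_derive1_powR b u0).
have dotC : class_C k [set u | 0 < norm2 u] (fun u => (b * 2) *: (dot u v : R^o)).
  apply: class_CZ; first exact: open_norm2_pos.
  exact: class_C_sub (class_C_dot k v).
apply: (class_C_eq open_norm2_pos _ (class_CM open_norm2_pos (IH (b - 1)) dotC)) => u u0.
rewrite (@derive_val _ _ _ _ _ _ _ (is_derive_radial v (is_derive1_powR b u0))).
by rewrite /GRing.scale /=; ring.
Qed.

Lemma class_C_radial_model k e :
  class_C k [set u | 0 < norm2 u] (fun u => model_fun e (norm2 u)).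
Proof.
have [->|e1] := eqVneq e (-1); last first.
  have -> : (fun u => model_fun e (norm2 u)) = (fun u => norm2 u `^ ((1 + e) / 2)).
    by apply/funext => u; rewrite /model_fun (negPf e1).
  exact: class_C_radial_powR.
have dm u : 0 < norm2 u -> is_derive (norm2 u) 1 (model_fun (-1)) (model_slope (-1) (norm2 u)).
  exact: is_derive_model_fun.
apply: class_CW; split=> [u u0|v]; first exact: differentiable_radial (dm _ u0).
have dotC : class_C k [set u | 0 < norm2 u] (fun u => 2 *: (dot u v : R^o)).
  apply: class_CZ; first exact: open_norm2_pos.
  exact: class_C_sub (class_C_dot k v).
apply: (class_C_eq open_norm2_pos _
  (class_CM open_norm2_pos (class_C_radial_powR k ((-1 - 1) / 2)) dotC)) => u u0.
rewrite (@derive_val _ _ _ _ _ _ _ (is_derive_radial v (dm _ u0))).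
by rewrite /model_slope eqxx mul1r.
Qed.

Lemma derive2_radial (phi phi1 : R -> R) (d : R) u v w :
  (\forall x \near u, is_derive (norm2 x) 1 phi (phi1 (norm2 x))) ->
  is_derive (norm2 u) 1 phi1 d ->
  'D_w ('D_v (fun x => phi (norm2 x))) u =
  4 * d * dot u w * dot u v + 2 * phi1 (norm2 u) * dot w v.
Proof.
move=> dphi dphi1.
have near_D : \forall x \near u, 'D_v (fun x => phi (norm2 x)) x =
    phi1 (norm2 x) * (2 *: (dot x v : R^o)).
  apply: filterS dphi => x dx.
  by rewrite (@derive_val _ _ _ _ _ _ _ (is_derive_radial v dx)).
rewrite (near_eq_derive _ near_D).
have DD := is_deriveM (is_derive_radial w dphi1) (is_deriveZ 2 (is_derive_dot u v w)).
rewrite (@derive_val _ _ _ _ _ _ _ DD) /GRing.scale /= /GRing.scale /=.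
by move: (phi1 _) => x; ring.
Qed.

Lemma dot_basis u : (dot u e0 = u 0 0) * (dot u e1 = u 0 1).
Proof. by rewrite /dot !coord_basis; split; ring. Qed.

(** The Hessian of [phi(x^2 + y^2)] is [2 phi'] times the identity plus
    [4 phi''] times the outer square of the position vector, which is thus an
    eigenvector, and so are the vectors orthogonal to it. *)
Lemma char_poly_radial (phi phi1 : R -> R) (d : R) u (k1 k2 : R) :
  (\forall x \near u, is_derive (norm2 x) 1 phi (phi1 (norm2 x))) ->
  is_derive (norm2 u) 1 phi1 d ->
  k1 = 2 * phi1 (norm2 u) -> k2 = 2 * phi1 (norm2 u) + 4 * d * norm2 u ->
  char_poly (hessian (fun x => phi (norm2 x)) u) = ('X - k1%:P) * ('X - k2%:P).
Proof.
move=> dphi dphi1 -> ->; have D2 v w := derive2_radial v w dphi dphi1.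
apply/(char_poly_hessian _ _ (D2 e0 e0) (D2 e1 e1) (D2 e1 e0) (D2 e0 e1)).
rewrite !dot_basis !coord_basis /norm2.
by move: (phi1 _) => x; split; ring.
Qed.

Lemma model_curvatures e M p :
  e != 0 -> M p -> (forall q, M q -> zcoord q = model_fun e (axis_dist2 q)) ->
  0 < axis_dist2 p \/ e = 1 ->
  exists k1 k2, [/\ principal_curvatures M p k1 k2, k1 * k2 != 0 & k2 / k1 = e].
Proof.
move=> en0 Mp Mgraph pos; have two0 : 2 != 0 :> R by rewrite pnatr_eq0.
have [u0|e1] := pos.
  have slope0 := model_slope_neq0 e u0.
  exists (2 * model_slope e (axis_dist2 p)), (2 * e * model_slope e (axis_dist2 p)).
  split; last 2 first.
  - exact: mulf_neq0 (mulf_neq0 two0 slope0) (mulf_neq0 (mulf_neq0 two0 en0) slope0).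
  - by move: (model_slope _ _) slope0 => x x0; field.
  exists (fun u => model_fun e (norm2 u)); split.
    split; first exists [set u | 0 < norm2 u]; first split.
    + exact: open_norm2_pos.
    + by rewrite /= norm2_top_view.
    + exact: class_C_radial_model.
    + by apply: (@filterS _ (nbhs p) _ setT _ _ filterT) => q _ /Mgraph ->;
        rewrite norm2_top_view.
  rewrite -norm2_top_view in u0 *.
  have near_d : \forall x \near top_view p,
      is_derive (norm2 x) 1 (model_fun e) (model_slope e (norm2 x)).
    apply: filterS (open_nbhs_nbhs (conj open_norm2_pos u0)) => x x0.
    exact: is_derive_model_fun.
  apply: (char_poly_radial near_d (is_derive_model_slope e u0)) => //.
  by move: (model_slope _ _) => x; field; exact: lt0r_neq0.
exists 2, 2; split; last 2 first.
- exact: mulf_neq0.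
- by rewrite divff.
exists norm2; split.
  split; first by exists setT; split=> //; [exact: openT|exact: class_C_norm2].
  apply: (@filterS _ (nbhs p) _ setT _ _ filterT) => q _ /Mgraph ->.
  by rewrite e1 model_fun1 ?axis_dist2_ge0// norm2_top_view.
have d1 : \forall x \near top_view p, is_derive (norm2 x) 1 id (cst 1 (norm2 x)).
  by apply: (@filterS _ (nbhs (top_view p)) _ setT _ _ filterT) => x _; exact: is_derive_id.
apply: (@char_poly_radial id (cst 1) 0 (top_view p) 2 2 d1
  (is_derive_cst (1 : R) (norm2 (top_view p)) (1 : R))).
  by rewrite mulr1.
by rewrite mulr1 mulr0 mul0r addr0.
Qed.

End Models.

Section ModelAxis.
Context {R : realType}.
Implicit Types (b e : R).

Lemma powR_sqr_continuous0 b : 0 < b -> {for 0, continuous (fun t : R => (t ^+ 2) `^ b)}.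
Proof.
move=> b0; apply/cvgrPdist_lt => eps eps0.
have rt0 : 0 < eps `^ b^-1 by rewrite powR_gt0.
have sqr0 : (fun t : R => t ^+ 2) @ (0 : R) --> (0 : R).
  have := is_derive_continuous (is_derive_sqr (0 : R)).
  by rewrite /prop_for /continuous_at expr0n.
have := sqr0 _ (lt_nbhsl rt0) => /= near_small.
apply: (@filterS _ (nbhs (0 : R)) _ _ _ _ near_small) => t /= small.
rewrite expr0n powR0 ?gt_eqF// sub0r normrN ger0_norm ?powR_ge0//.
have -> : eps = (eps `^ b^-1) `^ b.
  by rewrite -powRrM mulVf ?gt_eqF// powRr1 // ltW.
by rewrite gt0_ltr_powR// ?nnegrE ?sqr_ge0// ltW.
Qed.

Lemma model_graph_ode (f : 'rV[R]_2 -> R) e (s : R) : 0 < s ->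
  (\forall t \near s, thrice_differentiable f (pt2 t 0)) ->
  (\forall t \near s, 0 < t -> model_fun e (t ^+ 2) - f (pt2 t 0) = 0) ->
  s * 'D_e0 ('D_e0 f) (pt2 s 0) - e * 'D_e0 f (pt2 s 0) = 0.
Proof.
move=> s0 smooth graph.
have dhf : \forall t \near s,
    is_derive (t : R) 1 (fun t => model_fun e (t ^+ 2) - f (pt2 t 0))
      (2 * t * model_slope e (t ^+ 2) - 'D_e0 f (pt2 t 0)).
  apply: filterS (filterI smooth (lt_nbhsr s0)) => t [[df _ _] t0].
  exact: is_deriveB (is_derive_model_sqr e t0) (is_derive_axis df).
have h1f := derive_flat limit_point_pos_self dhf graph.
have [_ df _] := nbhs_singleton smooth.
have [h1 h2] := derive_limit_zeros
  (is_deriveB (is_derive_model_slope_sqr e s0) (is_derive_axis (df e0)))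
  (limit_point_pos_self s0) h1f.
have <- : 2 * s * model_slope e (s ^+ 2) = 'D_e0 f (pt2 s 0).
  by apply/eqP; rewrite -subr_eq0; apply/eqP; exact: h1.
have <- : 2 * e * model_slope e (s ^+ 2) = 'D_e0 ('D_e0 f) (pt2 s 0).
  by apply/eqP; rewrite -subr_eq0; apply/eqP; exact: h2.
by move: (model_slope _ _) => x; ring.
Qed.

(** For [e != 1] the model has no nonzero Gaussian curvature at the origin, even
    when it happens to be smooth there: a local graph [f] satisfies
    [s f_xx = e f_x] on the positive x-axis, and differentiating at 0 gives
    [f_xx = e f_xx], while [f_xx^2] is the Gaussian curvature. *)
Lemma power_surface_axis e p :
  e != -1 -> 0 < (1 + e) / 2 -> power_surface ((1 + e) / 2) p -> axis_dist2 p = 0 ->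
  (exists K, gaussian_curvature (power_surface ((1 + e) / 2)) p K /\ K != 0) -> e = 1.
Proof.
move=> e1 b0; set b := (1 + e) / 2 in b0 *; set M := power_surface b => Mp p0.
move=> [K [[k1 [k2 [[f [lf char_f]] ->]]] K0]].
pose h (t : R) := model_fun e (t ^+ 2).
have hE : h = (fun t : R => (t ^+ 2) `^ b).
  by apply/funext => t; rewrite /h /model_fun (negPf e1).
have h0 : h 0 = 0 by rewrite hE expr0n powR0 // gt_eqF.
have rotM : rotation_invariant M.
  by move=> q q' [dq zq] qq' zqq'; rewrite /M /power_surface /= -qq' -zqq'.
have pE : p = pt3 0 0 (h 0).
  have [_ zp] := Mp; move: (p0) => /eqP; rewrite paddr_eq0 ?sqr_ge0// !sqrf_eq0.
  move=> /andP[/eqP xp /eqP yp].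
  by rewrite [LHS]pt3E xp yp zp p0 h0 powR0 // gt_eqF.
rewrite pE in lf char_f.
pose P := [set t : R | 0 < t].
have Ph s : P s -> 0 < s /\ M (pt3 s 0 (h s)).
  move=> s0; split=> //; rewrite /M /power_surface /= !coord_pt3 axis_dist2_pt3.
  by rewrite expr0n addr0 exprn_gt0 // hE; split=> //; left.
have hc : {for 0, continuous h} by rewrite hE; exact: powR_sqr_continuous0.
have [hf f01 /(_ erefl) f11] := profile_hessian rotM Ph limit_point_pos hc lf.
rewrite coord_pt3 in char_f.
have fxx0 : 'D_e0 ('D_e0 f) (pt2 0 0) != 0.
  have [x [y [-> yE _ prod]]] := curvatures_of_triangular char_f f01.
  by apply: contraNneq K0 => x0; rewrite prod x0 mul0r.
have smooth : \forall s \near (0 : R), thrice_differentiable f (pt2 s 0).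
  exact: local_graph_smooth_axis lf.
have near_ode : \forall s \near (0 : R), P s ->
    s * 'D_e0 ('D_e0 f) (pt2 s 0) - e * 'D_e0 f (pt2 s 0) = 0.
  apply: filterS (filterI (near_join hf) (near_join smooth)) => s [hfs smooth_s] s0.
  exact: model_graph_ode s0 smooth_s hfs.
have [_ df ddf] := nbhs_singleton smooth.
have DD := is_deriveB (is_deriveM (is_derive_id (0 : R) (1 : R))
    (is_derive_axis (ddf e0 e0))) (is_deriveZ e (is_derive_axis (df e0))).
have [_] := derive_limit_zeros DD limit_point_pos near_ode.
rewrite /GRing.scale /= mul0r add0r mulr1 => E.
by apply: (mulIf fxx0); rewrite mul1r; apply/esym/eqP; rewrite -subr_eq0 E.
Qed.

End ModelAxis.

(** * The classification *)

Section ModelSurfaces.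
Context {R : realType}.
Implicit Types (a e : R) (S M : set 'rV[R]_3).

(** The models for [a] are those with [e = a] and [e = a^-1]; the exponents of
    [model_surface] are [(1 + e) / 2]. *)
Definition model_set e : set 'rV[R]_3 :=
  if e == -1 then log_surface else power_surface ((1 + e) / 2).

Lemma model_surfaceP a M : a != 0 ->
  model_surface a M <-> exists2 e, e = a \/ e = a^-1 & M = model_set e.
Proof.
move=> a0.
have inv_a : (1 + a^-1) / 2 = (1 + a) / (2 * a) by field.
have inv_m1 : (a^-1 == -1) = (a == -1).
  by rewrite -[in RHS](inj_eq (@invr_inj R)) invrN invr1.
split.
- move=> [[am1 [->|->]]|[-> ->]].
  + by exists a; [left|rewrite /model_set (negPf am1)].
  + by exists a^-1; [right|rewrite /model_set inv_m1 (negPf am1) inv_a].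
  + by exists (-1); [left|rewrite /model_set eqxx].
- move=> [e ea ->]; have [a1|a1] := eqVneq a (-1).
    right; split=> //; have -> : e = -1 by case: ea => ->; rewrite a1 // invrN invr1.
    by rewrite /model_set eqxx.
  left; split=> //; case: ea => ->; [left|right].
    by rewrite /model_set (negPf a1).
  by rewrite /model_set inv_m1 (negPf a1) inv_a.
Qed.

Lemma model_set_graph e q : model_set e q -> zcoord q = model_fun e (axis_dist2 q).
Proof. by rewrite /model_set /model_fun; case: ifP => _ []. Qed.

Lemma model_setI e q : 0 < axis_dist2 q \/ e = 1 ->
  zcoord q = model_fun e (axis_dist2 q) -> model_set e q.
Proof.
rewrite /model_set /model_fun => pos; case: ifPn => [/eqP e1|e1] zq; split=> //.
  case: pos => [//|e1']; exfalso; move: e1 => /eqP.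
  by rewrite e1' -subr_eq0 opprK -[_ + _ == 0]/(2%:R == 0 :> R) pnatr_eq0.
by case: pos => [|->]; [left|right; rewrite divr_gt0].
Qed.

Lemma model_set_off_axis e p : model_set e p ->
  (exists K, gaussian_curvature (model_set e) p K /\ K != 0) ->
  0 < axis_dist2 p \/ e = 1.
Proof.
have [|p0] := ltP 0 (axis_dist2 p); first by left.
have {}p0 : axis_dist2 p = 0 by apply/eqP; rewrite eq_le p0 axis_dist2_ge0.
rewrite /model_set; case: ifPn => [_ [+ _]|e1 Mp curv]; first by rewrite p0 ltxx.
have [[+|b0] _] := Mp; first by rewrite p0 ltxx.
by right; exact: power_surface_axis e1 b0 Mp p0 curv.
Qed.

(** Both curvatures are scaled by the same factor. *)
Lemma ratio_pullback a S M (T : 'rV[R]_3 -> 'rV[R]_3) p :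
  general_isotropic_similarity T -> (forall q, S q -> M (T q)) ->
  (exists k1 k2, [/\ principal_curvatures M (T p) k1 k2, k1 * k2 != 0 &
    k1 / k2 = a \/ k2 / k1 = a]) ->
  exists k1 k2, [/\ principal_curvatures S p k1 k2, k1 * k2 != 0 &
    k1 / k2 = a \/ k2 / k1 = a].
Proof.
move=> simT SM [k1 [k2 [curv k0 ratio]]].
have [l l0 curvS] := principal_curvatures_pullback simT SM curv.
exists (l * k1), (l * k2); split=> //.
  by rewrite mulrACA; apply: mulf_neq0 => //; exact: mulf_neq0.
by rewrite -!mulf_div divff // !mul1r.
Qed.

End ModelSurfaces.

Theorem proposition3 (R : realType) (a : R) (S : set 'rV[R]_3)
    (a_neq0 : a != 0)
    (S_admissible : admissible S)
    (S_rotational : isotropic_rotational S) :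
  constant_ratio a S <->
  exists M N : set 'rV[R]_3,
    [/\ model_surface a M,
        N `<=` M,
        (forall p, N p -> exists K, gaussian_curvature M p K /\ K != 0) &
        isotropic_similar S N].
Proof.
split=> [ratioS|[M [N [+ NM curvN [T [simT TSN]]]]] p Sp].
  have [S0 [T0 [surfS0 rotS0 congT0 T0S0]]] := S_rotational.
  have simT0 := congruence_similarity congT0.
  have S0S q : S0 q -> S (T0 q) by move=> S0q; rewrite -T0S0; exists q.
  have ratioS0 : constant_ratio a S0.
    by move=> q S0q; apply: (ratio_pullback simT0 S0S); apply: ratioS; exact: S0S.
  have rotinvS0 := z_rotation_invariant rotS0.
  have [e [C [D [ea C0 on_S0 axis]]]] :=
    global_profile a_neq0 surfS0 rotinvS0 ratioS0.
  have en0 : e != 0 by case: ea => ->; rewrite ?invr_eq0.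
  (* [T1] maps [z = C m + D] to [z = m]. *)
  pose T1 := affine_map (isotropic_mx false 1 0 0 0 C^-1) (pt3 0 0 (- D / C)).
  have simT1 : general_isotropic_similarity T1.
    exists false, 1, 0, 0, 0, C^-1, (pt3 0 0 (- D / C)); split=> //.
    by rewrite isotropic_mx_unit expr1n expr0n addr0 oner_neq0 invr_eq0.
  have T1E q : T1 q = pt3 (xcoord q) (ycoord q) ((zcoord q - D) / C).
    by rewrite /T1 isotropic_affineE !coord_pt3 expr0; congr pt3; ring.
  have T1S0 q : S0 q -> (0 < axis_dist2 (T1 q) \/ e = 1) /\ model_set e (T1 q).
    move=> S0q; have dq : axis_dist2 (T1 q) = axis_dist2 q.
      by rewrite T1E axis_dist2_pt3.
    have pos : 0 < axis_dist2 (T1 q) \/ e = 1.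
      rewrite dq lt0r axis_dist2_ge0 andbT; have [q0|_] := eqVneq (axis_dist2 q) 0.
        by right; case: ea => ->; rewrite (axis _ S0q q0) ?invr1.
      by left.
    split=> //; apply: model_setI => //.
    by rewrite dq T1E zcoord_pt3 (on_S0 _ S0q) addrK mulrC mulKf.
  have [T0' [simT0' T0K]] := similarity_inverse simT0.
  exists (model_set e), (T1 @` S0); split.
  - by apply/model_surfaceP => //; exists e.
  - by move=> _ [q /T1S0[_ +] <-].
  - move=> _ [q S0q <-]; have [pos Mq] := T1S0 _ S0q.
    have [k1 [k2 [curv k0 _]]] :=
      model_curvatures en0 Mq (@model_set_graph R e) pos.
    by exists (k1 * k2); split=> //; exists k1, k2.
  - exists (T1 \o T0'); split; first exact: similarity_comp.
    rewrite -T0S0; apply/seteqP; split=> [_ [_ [q S0q <-] <-]|_ [q S0q <-]].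
      by exists q; rewrite //= T0K.
    by exists (T0 q); [exists q|rewrite /= T0K].
move=> /model_surfaceP -/(_ a_neq0)[e ea ME]; rewrite {}ME in NM curvN.
have SN q : S q -> N (T q) by move=> Sq; rewrite -TSN; exists q.
have en0 : e != 0 by case: ea => ->; rewrite ?invr_eq0.
have Mp := NM _ (SN _ Sp).
have pos := model_set_off_axis Mp (curvN _ (SN _ Sp)).
have [k1 [k2 [curv k0 ratio]]] :=
  model_curvatures en0 Mp (@model_set_graph R e) pos.
apply: (ratio_pullback simT (fun q Sq => NM _ (SN _ Sq))); exists k1, k2; split=> //.
by case: ea => ea; [right; rewrite ratio|left; rewrite -invf_div ratio ea invrK].
Qed.
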